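(* Let $K\subset\mathbb{R}^n$ be a symmetric convex body. Then $T^1(K)$ is the dual of $S^1_0(K)$, in the following sense. (i) Every $\mu\in T^1(K)$ defines a bounded linear functional on $S^1_0(K)$ by $f\mapsto\int_{\mathbb{R}^{n+1}_+} f\,d\mu$, where the integral is absolutely convergent, and the norm of this functional is comparable to $\|\mu\|_{T^1(K)}$. (ii) Conversely, for every continuous linear functional $l$ on $S_0^1(K)$ there exists a unique measure $\mu\in T^1(K)$ such that $$l(f)=\int_{\mathbb{R}^{n+1}_+} f\,d\mu\quad (f\in S^1_0(K)),\qquad \|l\|_{S^1_0(K)^*}\simeq\|\mu\|_{T^1(K)}.$$ All implied constants depend only on the dimension $n$.
   Context: A symmetric convex body $K\subset\mathbb{R}^n$ is a compact convex set with nonempty interior such that $-x\in K$ whenever $x\in K$; $\|\cdot\|_K$ is the norm whose closed unit ball is $K$. For $x\in\mathbb{R}^n$, $t>0$, $B(x,t)=\{y:\|y-x\|_K\le t\}$; such sets are called $K$-balls. $\mathbb{R}^{n+1}_+=\mathbb{R}^n\times(0,\infty)$. A point $(x,t)\in\mathbb{R}^{n+1}_+$ is identified with the $K$-ball $B=B(x,t)$, and for a function $f$ on $\mathbb{R}^{n+1}_+$ one writes $f_B=f(x,t)$. $S^1(K)$ is the space of all continuous functions $f$ on $\mathbb{R}^{n+1}_+$ with $\|f\|_{S^1(K)}:=\sup_{\mathcal{C}}\sum_{B\in\mathcal{C}}|f_B|<\infty$, the supremum being over all finite collections $\mathcal{C}$ of pairwise disjoint $K$-balls. $S^1_0(K)$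 is the closure in $S^1(K)$ of $C_c(\mathbb{R}^{n+1}_+)$, the compactly supported continuous functions on $\mathbb{R}^{n+1}_+$. For $x\in\mathbb{R}^n$, $\Gamma_x=\{(y,t)\in\mathbb{R}^{n+1}_+:\|x-y\|_K\le t\}$. $T^1(K)$ is the space of all (signed) Radon measures $\mu$ on $\mathbb{R}^{n+1}_+$, with total variation measure $|\mu|$ (finite on compact sets), such that $\|\mu\|_{T^1(K)}:=\|A_1(\mu)\|_{L^\infty(\mathbb{R}^n)}<\infty$, where $A_1(\mu)(x):=|\mu|(\Gamma_x)$. $A\simeq B$ means $c^{-1}A\le B\le cA$ for a constant $c\ge 1$ as specified. *)

(* Defs.v *)
From HB Require Import structures.
From mathcomp Require Import all_boot all_order all_algebra.
From mathcomp Require Import all_classical all_reals all_analysis.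

Set Implicit Arguments.
Unset Strict Implicit.
Unset Printing Implicit Defensive.

Import Order.TTheory GRing.Theory Num.Theory.
Import numFieldNormedType.Exports.

Local Open Scope classical_set_scope.
Local Open Scope ring_scope.

Section convex_body.
Context {R : realType} {n : nat}.
Implicit Type K : set 'rV[R]_n.

Definition symmetric_convex_body K : Prop :=
  [/\ compact K, convex_set (K : set (convex_lmodType 'rV[R]_n)),
      K^° !=set0 & forall x, K x -> K (- x)].

(* The Minkowski functional: for a symmetric convex body K, this is the norm
   with closed unit ball K. *)
Definition body_norm K (x : 'rV[R]_n) : R :=
  inf [set r | 0 < r /\ K (r^-1 *: x)].

Definition body_ball K (x : 'rV[R]_n) (t : R) : set 'rV[R]_n :=
  [set y | body_norm K (y - x) <= t].

End convex_body.

Section lebesgue_null.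
Context {R : realType} {n : nat}.
Local Open Scope ereal_scope.

Definition box (a b : 'rV[R]_n) : set 'rV[R]_n :=
  [set x | forall i, (a ord0 i <= x ord0 i <= b ord0 i)%R].

Definition box_volume (a b : 'rV[R]_n) : R :=
  (\prod_(i < n) (b ord0 i - a ord0 i))%R.

Definition lebesgue_outer (A : set 'rV[R]_n) : \bar R :=
  ereal_inf [set v | exists a b : nat -> 'rV[R]_n,
    [/\ forall k i, (a k ord0 i <= b k ord0 i)%R,
        A `<=` \bigcup_k box (a k) (b k)
      & v = \sum_(0 <= k <oo) (box_volume (a k) (b k))%:E]].

Definition Linfty_norm (g : 'rV[R]_n -> \bar R) : \bar R :=
  ereal_inf [set M | lebesgue_outer [set x | M < `|g x|] = 0].

End lebesgue_null.

Section upper_half_space.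
Variables (R : realType) (n : nat).

Definition upper_half : Type :=
  set_type [set p : 'rV[R]_n * R | 0 < p.2].

HB.instance Definition _ := Choice.on upper_half.
HB.instance Definition _ := PseudoMetric.on upper_half.

Definition ball_center (p : upper_half) : 'rV[R]_n := (set_val p).1.

Definition ball_radius (p : upper_half) : R := (set_val p).2.

Lemma upper_half_point_subproof :
  ((0, 1) : 'rV[R]_n * R) \in [set p : 'rV[R]_n * R | 0 < p.2].
Proof. by rewrite inE /= ltr01. Qed.

HB.instance Definition _ :=
  isPointed.Build upper_half (SigSub upper_half_point_subproof).

Definition borel_half := g_sigma_algebraType (@open upper_half).

End upper_half_space.

Section S1_norm.
Context {R : realType} {n : nat} (K : set 'rV[R]_n).
Local Notation H := (upper_half R n).
Local Open Scope ereal_scope.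

Definition ball_of (p : H) : set 'rV[R]_n := body_ball K (ball_center p) (ball_radius p).

(* The finite collections of pairwise disjoint K-balls. *)
Definition disjoint_balls : set (set H) :=
  [set C | finite_set C /\ trivIset C ball_of].

Definition S1_norm (f : H -> R) : \bar R :=
  ereal_sup [set \sum_(p \in C) `|f p|%:E | C in disjoint_balls].

Definition in_S1 : {pred H -> R} :=
  [pred f | `[< continuous f /\ S1_norm f < +oo >]].

End S1_norm.

Section S1_norm_theory.
Context {R : realType} {n : nat} (K : set 'rV[R]_n).
Local Notation H := (upper_half R n).
Implicit Types f g : H -> R.
Local Open Scope ereal_scope.

Lemma disjoint_balls1 (p : H) : disjoint_balls K [set p].
Proof. by split=> [|i j /= -> ->]; first exact: finite_set1. Qed.

Lemma S1_norm_ge f (p : H) : `|f p|%:E <= S1_norm K f.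
Proof.
apply: ereal_sup_ubound; exists [set p]; first exact: disjoint_balls1.
by rewrite fsbig_set1.
Qed.

Lemma S1_norm_ge0 f : 0 <= S1_norm K f.
Proof. by apply: le_trans (S1_norm_ge f point); rewrite lee_fin. Qed.

Lemma S1_normD f g : S1_norm K (f + g)%R <= S1_norm K f + S1_norm K g.
Proof.
apply: ge_ereal_sup => _ [C CK <-].
have fC : finite_set C by case: CK.
have le (h : H -> R) : \sum_(p \in C) `|h p|%:E <= S1_norm K h.
  by apply: ereal_sup_ubound; exists C.
apply: le_trans (leeD (le f) (le g)).
rewrite -fsbig_split//=; apply: lee_fsum => // p _.
by rewrite -EFinD lee_fin ler_normD.
Qed.

Lemma S1_normZ_le (a : R) f : S1_norm K (a *: f)%R <= `|a|%:E * S1_norm K f.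
Proof.
apply: ge_ereal_sup => _ [C CK <-].
have fC : finite_set C by case: CK.
under eq_fsbigr do rewrite /GRing.scale/= normrM EFinM.
rewrite -ge0_mule_fsumr; last by move=> p; rewrite lee_fin.
by apply: lee_wpmul2l; rewrite ?lee_fin//; apply: ereal_sup_ubound; exists C.
Qed.

Lemma S1_normZ (a : R) f : S1_norm K (a *: f)%R = `|a|%:E * S1_norm K f.
Proof.
have [->|a0] := eqVneq a 0%R.
  rewrite normr0 mul0e; apply/eqP; rewrite eq_le S1_norm_ge0 andbT.
  by apply: le_trans (S1_normZ_le _ _) _; rewrite normr0 mul0e.
apply/eqP; rewrite eq_le S1_normZ_le/=.
rewrite -{1}(scalerK a0 f).
apply: le_trans (lee_wpmul2l _ (S1_normZ_le _ _)) _; first by rewrite lee_fin.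
by rewrite muleA -EFinM -normrM mulfV// normr1 mul1e.
Qed.

Lemma in_S1_submod_closed : submod_closed (in_S1 K).
Proof.
split.
  apply/asboolP; split; first exact: cst_continuous.
  by rewrite -(scale0r (0 : H -> R)%R) S1_normZ normr0 mul0e ltry.
move=> a f g /asboolP[cf Nf] /asboolP[cg Ng]; apply/asboolP; split.
  by move=> p; exact: (cvgD (cvgM (cvg_cst a) (cf p)) (cg p)).
apply: le_lt_trans (S1_normD _ _) _; rewrite S1_normZ lte_add_pinfty//.
by rewrite lte_mul_pinfty// lee_fin.
Qed.

HB.instance Definition _ :=
  GRing.isSubmodClosed.Build R (H -> R) (in_S1 K) in_S1_submod_closed.

End S1_norm_theory.

Section S1.
Context {R : realType} {n : nat} (K : set 'rV[R]_n).
Local Notation H := (upper_half R n).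

Record S1 := MkS1 { S1_fun :> H -> R; S1_funP : S1_fun \in in_S1 K }.

HB.instance Definition _ := [isSub for S1_fun].
HB.instance Definition _ := [Choice of S1 by <:].
HB.instance Definition _ := [SubChoice_isSubLmodule of S1 by <:].

Let N (f : S1) : R := fine (S1_norm K f).

Lemma S1_norm_fin_num (f : S1) : S1_norm K f \is a fin_num.
Proof.
by have /asboolP[_ Nf] := S1_funP f; rewrite ge0_fin_numE// S1_norm_ge0.
Qed.

Let N_D f g : N (f + g) <= N f + N g.
Proof.
rewrite -lee_fin EFinD !fineK ?S1_norm_fin_num//; exact: S1_normD.
Qed.

Let N_Z a f : N (a *: f) = `|a| * N f.
Proof.
by apply: EFin_inj; rewrite EFinM !fineK ?S1_norm_fin_num//; exact: S1_normZ.
Qed.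

Let N_eq0 f : N f = 0 -> f = 0.
Proof.
move=> Nf0; apply: val_inj; apply/funext => p /=.
apply/eqP; rewrite -normr_le0 -lee_fin.
apply: le_trans (S1_norm_ge K f p) _.
by rewrite -(fineK (S1_norm_fin_num f)) lee_fin -/(N f) Nf0.
Qed.

HB.instance Definition _ := Lmodule_isNormed.Build R S1 N_D N_Z N_eq0.

Lemma S1_normE (f : S1) : `|f|%:E = S1_norm K f.
Proof. by rewrite -(fineK (S1_norm_fin_num f)). Qed.

Definition S1_0 : set S1 :=
  closure [set f : S1 | compact (closure [set p | f p != 0])].

End S1.

Arguments S1_0 {R n} K _ : rename.

Section signed_radon.
Context {R : realType} {n : nat}.
Local Notation H := (upper_half R n).
Local Open Scope ereal_scope.

Definition relcompact_borel : set (set H) :=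
  [set A | measurable (A : set (borel_half R n)) /\
           exists2 C, compact C & A `<=` C].

(* A signed Radon measure may have infinite positive and negative parts, so it
   is a real set function on the relatively compact Borel sets that restricts
   to a finite signed measure on each compact set; its values on other sets are
   irrelevant. *)
Definition signed_radon (mu : set H -> R) : Prop :=
  forall C : set H, compact C ->
    exists nu : {charge set (borel_half R n) -> \bar R},
      forall A : set (borel_half R n), measurable A -> A `<=` C ->
        (mu A)%:E = nu A.

Definition upper_variation (mu : set H -> R) (E : set (borel_half R n))
    : \bar R :=
  ereal_sup [set (mu A)%:E | A in [set A | relcompact_borel A /\ A `<=` E]].

Definition lower_variation (mu : set H -> R) (E : set (borel_half R n))
    : \bar R :=
  upper_variation (fun A => - mu A)%R E.

Definition variation_measure (mu : set H -> R) (E : set (borel_half R n))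
    : \bar R :=
  upper_variation mu E + lower_variation mu E.

(* Meaningful when f is integrable for variation_measure mu. *)
Definition signed_integral (mu : set H -> R) (f : H -> R) : R :=
  (fine (\int[upper_variation mu]_p (f p)%:E) -
   fine (\int[lower_variation mu]_p (f p)%:E))%R.

End signed_radon.

Section T1.
Context {R : realType} {n : nat} (K : set 'rV[R]_n).
Local Notation H := (upper_half R n).
Local Open Scope ereal_scope.

Definition cone (x : 'rV[R]_n) : set H :=
  [set p | (body_norm K (x - ball_center p) <= ball_radius p)%R].

Definition A1 (mu : set H -> R) (x : 'rV[R]_n) : \bar R :=
  variation_measure mu (cone x).

Definition T1_norm (mu : set H -> R) : \bar R := Linfty_norm (A1 mu).

Definition T1 : set (set H -> R) :=
  [set mu | signed_radon mu /\ T1_norm mu < +oo].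

End T1.

Section functionals.
Context {R : realType} {V : normedModType R}.

(* Functionals on a subspace A of V are represented by functions on V, only the
   values on A being relevant. *)
Definition linear_on (A : set V) (l : V -> R) : Prop :=
  forall (a : R) (f g : V), A f -> A g -> l (a *: f + g) = a * l f + l g.

Definition dual_norm (A : set V) (l : V -> R) : \bar R :=
  ereal_sup [set `|l f|%:E | f in [set f | A f /\ `|f| <= 1]].

End functionals.

Definition comparable_by {R : realType} (c : R) (a b : \bar R) : Prop :=
  ((c^-1)%:E * a <= b /\ b <= c%:E * a)%E.

(* Main.v *)
From HB Require Import structures.
From mathcomp Require Import perm finmap.
Require Import Defs.
From mathcomp Require Import all_boot all_order all_algebra.
From mathcomp Require Import all_classical all_reals all_analysis.
From mathcomp Require Import measurable_realfun lra ring.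
Set Implicit Arguments.
Unset Strict Implicit.
Unset Printing Implicit Defensive.
Import Order.TTheory GRing.Theory Num.Theory.
Import numFieldNormedType.Exports.
Local Open Scope classical_set_scope.
Local Open Scope ring_scope.

(** A measure in T1 and a bounded functional on S1_0 are exchanged by the Riesz
representation theorem, so that two estimates remain, one for each direction.

From measures to functionals ([carleson_embedding]): if nu is a measure on the
upper half space with nu (cone x) <= M for almost all x, then the integral of |f|
is at most c M times the S1 norm of f. On a compact set cut nu into small pieces
near points p_k, of masses w_k; the integral is almost the sum of the
w_k |f(p_k)|. Fix a ball p_i and consider the balls p_k that meet it and are at
least as large. Their points (y, s) satisfy N(x - y) <= s + 3/2 t and s >= t, for x
the center and t nearly the radius of p_i, and a box of this kind is covered by a
number of cones that depends on n only ([cone_cover]); the vertices of these cones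
may be chosen in any given dense set, hence outside of a null set
([lebesgue_null_dense]). So the total mass of these neighbours is at most c M. A
greedy argument on weights, which treats the smallest balls first
([weighted_sum_le_independent]), then produces a family of pairwise disjoint balls
over which the sum of |f|, multiplied by c M, bounds the weighted sum. The sum
over a disjoint family is at most the S1 norm. That c does not depend on K comes
from a basis of nearly maximal determinant with vectors in K ([body_basis]), which
compares K with a parallelepiped up to a factor that depends on n only.

From functionals to measures ([functional_measure]): on the continuous functions
with compact support a bounded functional l is the difference of two positive
measures P and Q, where P U is the supremum of the values l g over the functions
g with 0 <= g <= 1 that vanish outside of the open set U. When U is the open cone
with vertex z, all the balls in U contain z, so that a disjoint family contains at
most one of them; such g have S1 norm at most 1, and P U is at most the norm of l.
Finitely many open cones, whose number depends on n only, cover any relatively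
compact part of a closed cone. The same bound holds for Q, and P + Q dominates the
total variation of P - Q.

Functions with compact support are dense in S1_0, which identifies l with the
integral on all of S1_0. A signed Radon measure is determined by these integrals
([signed_radon_unique]); therefore the second estimate, applied to the functional
that a measure of T1 defines, bounds the T1 norm of this very measure. *)

Section row_vector_norm.
Context {R : realType} {n : nat}.

Lemma rV_norm_leP (x : 'rV[R]_n) (r : R) : 0 <= r ->
  (forall i, `|x ord0 i| <= r) <-> `|x| <= r.
Proof.
move=> r0; rewrite [ `|x|]/Num.norm/= mx_normrE; split=> [xr|].
  by apply: bigmax_le => // -[a b] _ /=; rewrite ord1.
by move=> xr i; apply: le_trans xr; exact: (le_bigmax _ _ (ord0, i)).
Qed.

Lemma rV_coord_le (x : 'rV[R]_n) i : `|x ord0 i| <= `|x|.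
Proof. exact: ((rV_norm_leP x (normr_ge0 x)).2 (lexx _) i). Qed.

End row_vector_norm.

(** * The norm of a symmetric convex body *)

Section body_norm_theory.
Context {R : realType} {n : nat} (K : set 'rV[R]_n).
Hypothesis Kbody : symmetric_convex_body K.
Implicit Types x y : 'rV[R]_n.

Lemma body_convex x y (a : R) :
  K x -> K y -> 0 <= a <= 1 -> K (a *: x + (1 - a) *: y).
Proof.
move=> Kx Ky a01; case: Kbody => _ Kconv _ _.
have := Kconv x y (Itv01 (andP a01).1 (andP a01).2).
by rewrite !inE => /(_ Kx Ky).
Qed.

Lemma body0 : K 0.
Proof.
case: Kbody => _ _ [x /nbhs_singleton Kx] Ksym.
have := @body_convex x (- x) 2^-1 Kx (Ksym _ Kx).
rewrite (_ : 1 - 2^-1 = 2^-1); last by field.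
by rewrite scalerN subrr; apply; apply/andP; split; lra.
Qed.

Lemma bodyZ x (a : R) : K x -> 0 <= a <= 1 -> K (a *: x).
Proof. by move=> Kx /(body_convex Kx body0); rewrite scaler0 addr0. Qed.

Lemma body_contains_ball : exists2 r : R, 0 < r & forall x, `|x| <= r -> K x.
Proof.
case: Kbody => _ _ [x0 /nbhs_normP[e /= e0 xeK]] Ksym.
exists (e / 4); first by rewrite divr_gt0.
move=> x xe; have -> : x = 2^-1 *: (x0 + 2 *: x) + (1 - 2^-1) *: - x0.
  rewrite (_ : 1 - 2^-1 = 2^-1); last by field.
  by rewrite -scalerDr addrAC subrr add0r scalerA mulVf ?scale1r.
apply: body_convex; last by apply/andP; split; lra.
- apply: xeK; rewrite /ball_/= opprD addNKr normrN normrZ ger0_norm//; lra.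
- by apply: Ksym; apply: xeK; rewrite /ball_/= subrr normr0.
Qed.

Lemma body_bounded : exists2 C : R, 0 < C & forall x, K x -> `|x| <= C.
Proof.
case: Kbody => /compact_bounded[M [_ KM]] _ _ _.
exists (`|M| + 1); first by rewrite ltr_wpDl.
by move=> x Kx; apply: KM Kx; rewrite (le_lt_trans (ler_norm _))// ltrDl.
Qed.

Local Notation N := (body_norm K).

Let gauge_lbound x : has_lbound [set r | 0 < r /\ K (r^-1 *: x)].
Proof. by exists 0 => r [/ltW]. Qed.

Lemma body_norm_le x r : 0 < r -> K (r^-1 *: x) -> N x <= r.
Proof. by move=> r0 Kx; apply: ge_inf. Qed.

Lemma body_gauge_nonempty x : [set r | 0 < r /\ K (r^-1 *: x)] !=set0.
Proof.
have [r r0 rK] := body_contains_ball.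
have c0 : 0 < (`|x| + 1) / r by rewrite divr_gt0// ltr_wpDl.
exists ((`|x| + 1) / r); split => //; apply: rK.
rewrite normrZ gtr0_norm ?invr_gt0// invf_div mulrAC ler_pdivrMr ?ltr_wpDl//.
by rewrite ler_pM2l// lerDl.
Qed.

Lemma body_norm_lt x r : N x < r -> K (r^-1 *: x).
Proof.
case/(inf_lt (body_gauge_nonempty x)) => s [s0 Ks] sr.
have r0 := lt_trans s0 sr.
have -> : r^-1 *: x = (s / r) *: (s^-1 *: x).
  by rewrite scalerA mulrAC divff ?gt_eqF// mul1r.
by apply: bodyZ => //; rewrite divr_ge0 ?ltW// ltr_pdivrMr// mul1r.
Qed.

Lemma body_norm_ge0 x : 0 <= N x.
Proof. by apply: lb_le_inf (body_gauge_nonempty x) _ => r [/ltW]. Qed.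

Lemma body_norm_le1 x : K x -> N x <= 1.
Proof. by move=> Kx; apply: body_norm_le => //; rewrite invr1 scale1r. Qed.

Lemma body_norm0 : N 0 = 0.
Proof.
apply/eqP; rewrite eq_le body_norm_ge0 andbT; apply/ler_addgt0Pl => r r0; rewrite addr0.
by apply: body_norm_le; rewrite // scaler0; exact: body0.
Qed.

Lemma body_normZ_ge0 x a : 0 <= a -> N (a *: x) <= a * N x.
Proof.
rewrite le_eqVlt => /predU1P[<-|a0]; first by rewrite scale0r mul0r body_norm0.
rewrite -ler_pdivrMl//; apply/ler_addgt0Pr => e e0.
have b0 : 0 < N x + e by rewrite ltr_wpDl ?body_norm_ge0.
rewrite ler_pdivrMl//; apply: body_norm_le; first by rewrite mulr_gt0.
rewrite scalerA invfM mulrAC mulVf ?gt_eqF// mul1r.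
by apply: body_norm_lt; rewrite ltrDl.
Qed.

Lemma body_normN x : N (- x) = N x.
Proof.
congr (inf _); apply/seteqP; split => r /= [r0]; case: Kbody => _ _ _ Ksym.
- by move=> /Ksym; rewrite scalerN opprK.
- by move=> /Ksym; rewrite -scalerN.
Qed.

Lemma body_normZ_le x a : N (a *: x) <= `|a| * N x.
Proof.
have [a0|a0] := ger0P a; first by rewrite body_normZ_ge0.
by rewrite -body_normN -scaleNr body_normZ_ge0// oppr_ge0 ltW.
Qed.

Lemma body_normD x y : N (x + y) <= N x + N y.
Proof.
apply/ler_addgt0Pl => e e0.
pose a := N x + e / 2; pose b := N y + e / 2.
have e2 : 0 < e / 2 by rewrite divr_gt0.
have a0 : 0 < a by rewrite ltr_wpDl ?body_norm_ge0.
have b0 : 0 < b by rewrite ltr_wpDl ?body_norm_ge0.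
have Ka : K (a^-1 *: x) by apply: body_norm_lt; rewrite ltrDl.
have Kb : K (b^-1 *: y) by apply: body_norm_lt; rewrite ltrDl.
have -> : e + (N x + N y) = a + b by rewrite /a /b; lra.
have ab0 : 0 < a + b by rewrite addr_gt0.
apply: body_norm_le => //.
have -> : (a + b)^-1 *: (x + y) =
    (a / (a + b)) *: (a^-1 *: x) + (1 - a / (a + b)) *: (b^-1 *: y).
  rewrite !scalerA scalerDr; congr (_ *: _ + _ *: _); field;
    by rewrite ?gt_eqF.
apply: body_convex => //.
by rewrite divr_ge0 ?ltW//= ltr_pdivrMr// mul1r ltrDl.
Qed.

Lemma body_norm_sub x y : N (x - y) = N (y - x).
Proof. by rewrite -body_normN opprB. Qed.

Lemma body_norm_tri x y z : N (x - z) <= N (x - y) + N (y - z).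
Proof. by rewrite (le_trans _ (body_normD _ _))// addrA subrK. Qed.

Lemma body_norm_sum (I : finType) (F : I -> 'rV[R]_n) :
  N (\sum_i F i) <= \sum_i N (F i).
Proof.
elim/big_ind2 : _ => [|a b c d ab cd|//]; first by rewrite body_norm0.
by rewrite (le_trans (body_normD _ _))// lerD.
Qed.

Lemma body_norm_le_norm : exists2 c : R, 0 < c & forall x, N x <= c * `|x|.
Proof.
have [r r0 rK] := body_contains_ball.
exists r^-1; rewrite ?invr_gt0// => x.
have [->|x0] := eqVneq x 0; first by rewrite body_norm0 normr0 mulr0.
have {}x0 : 0 < `|x| by rewrite normr_gt0.
apply: body_norm_le; first by rewrite mulr_gt0 ?invr_gt0.
apply: rK; rewrite normrZ gtr0_norm ?invr_gt0 ?mulr_gt0 ?invr_gt0//.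
by rewrite invfM invrK mulfVK// gt_eqF.
Qed.

Lemma body_norm_lipschitz :
  exists2 c : R, 0 < c & forall x y, `|N x - N y| <= c * `|x - y|.
Proof.
have [c c0 cN] := body_norm_le_norm; exists c => // x y.
have h u v : N u - N v <= c * `|u - v|.
  by rewrite lerBlDr -{1}(subrK v u) (le_trans (body_normD _ _))// lerD2r.
by rewrite ler_norml lerNl opprB h distrC h.
Qed.

Lemma continuous_body_norm : continuous N.
Proof.
have [c c0 Nc] := body_norm_lipschitz.
move=> x; apply/(@cvgrPdist_le _ _ _ (nbhs x)) => e e0.
near=> y; rewrite (le_trans (Nc _ _))// mulrC -ler_pdivlMr//.
by near: y; apply: cvgr_dist_le; rewrite ?divr_gt0//; exact: cvg_id.
Unshelve. all: by end_near. Qed.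

Lemma open_body_norm_lt x r : open [set z | N (z - x) < r].
Proof.
have cf : continuous (fun z : 'rV[R]_n => N (z - x)).
  move=> z; apply: (@continuous_comp _ _ _ (fun z : 'rV[R]_n => z - x) N z).
    exact: (@cvgB _ _ _ (nbhs z) _ id (cst x) z x cvg_id (cvg_cst x)).
  exact: continuous_body_norm.
have : open ((fun z : 'rV[R]_n => N (z - x)) @^-1` [set y | y < r]).
  by apply: open_comp => [z _|]; [exact: cf|exact: open_lt].
by [].
Qed.

End body_norm_theory.

(** * Covering a Carleson box by a bounded number of cones *)

Section cone_covering.
Context {R : realType} {n : nat} (K : set 'rV[R]_n).
Hypothesis Kbody : symmetric_convex_body K.
Local Notation N := (body_norm K).

(** Cramer's rule in row form: the coordinates of w in the rows of B are
    quotients of determinants. *)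
Lemma cramer_row (B : 'M[R]_n) (w : 'rV[R]_n) (i : 'I_n) :
  B \in unitmx ->
  \det (\matrix_k (if k == i then w else row k B)) =
  \det B * (w *m invmx B) ord0 i.
Proof.
move=> uB; rewrite (expand_det_row _ i).
rewrite /invmx uB -scalemxAr mxE mulrA divff ?mul1r; last first.
  by move: uB; rewrite unitmxE unitfE.
rewrite mxE; apply: eq_bigr => j _.
rewrite !mxE eqxx; congr (_ * _); rewrite /cofactor; congr (_ * \det _).
by apply/matrixP => a b; rewrite !mxE eq_sym (negbTE (neq_lift _ _)) mxE.
Qed.

Lemma det_bounded (C : R) :
  exists M : R, forall B : 'M[R]_n, (forall i j, `|B i j| <= C) -> `|\det B| <= M.
Proof.
exists (\sum_(s : 'S_n) \prod_(i < n) C) => B BC.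
apply: le_trans (ler_norm_sum _ _ _) _; apply: ler_sum => s _.
rewrite normrM normrX normrN1 expr1n mul1r normr_prod.
by apply: ler_prod => i _; rewrite normr_ge0 BC.
Qed.

(** An Auerbach basis up to a factor 2. When the determinant of B is at least
    half of its supremum over the bases in K, exchanging a row of B for a vector w
    of K increases it at most by the factor 2, and this factor is a coordinate of w. *)
Lemma body_basis : exists2 B : 'M[R]_n, (forall i, K (row i B)) &
  forall w, K w -> exists2 c : 'rV[R]_n, w = c *m B & forall i, `|c ord0 i| <= 2.
Proof.
pose S := [set `|\det B| | B in [set B : 'M[R]_n | forall i, K (row i B)]].
have [C C0 KC] := body_bounded Kbody.
have [r r0 rK] := body_contains_ball Kbody.
have rS : S (r ^+ n).
  exists (r%:M); last by rewrite det_scalar gtr0_norm// exprn_gt0.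
  move=> i; apply: rK; apply/rV_norm_leP => [|j]; first exact: ltW.
  rewrite !mxE; case: eqP => _; first by rewrite mulr1n ger0_norm// ltW.
  by rewrite mulr0n normr0 ltW.
have supS : has_sup S.
  split; first by exists (r ^+ n).
  have [M detM] := det_bounded C; exists M => _ [B KB <-].
  apply: detM => i j; apply: le_trans (KC _ (KB i)).
  by have := rV_coord_le (row i B) j; rewrite mxE.
have S0 : 0 < sup S.
  by apply: lt_le_trans (ub_le_sup _ rS); [rewrite exprn_gt0|case: supS].
have [_ [B KB <-]] := sup_adherent (divr_gt0 S0 (ltr0n R 2)) supS.
rewrite ltrBlDr => supB; exists B => // w Kw.
have uB : B \in unitmx.
  rewrite unitmxE unitfE -normr_gt0; lra.
exists (w *m invmx B); first by rewrite mulmxKV.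
move=> i; have dB0 : 0 < `|\det B| by lra.
rewrite -(ler_pM2l dB0) -normrM -cramer_row//.
suff : `|\det (\matrix_k (if k == i then w else row k B))| <= sup S by lra.
apply: ub_le_sup; first by case: supS.
by eexists; last reflexivity; move=> k /=; rewrite rowK; case: ifP.
Qed.

(** The grid of mesh 1/(2n) in the coordinates of such a basis: the coordinates
    of a point of 3K lie in [-6, 6], and rounding down the n coordinates costs at
    most 1/2 in norm. The size of the grid does not depend on the body. *)
Lemma body_net : exists g : {ffun 'I_n -> 'I_(24 * n).+1} -> 'rV[R]_n,
  forall w, K (3^-1 *: w) -> exists k, N (w - g k) <= 2^-1.
Proof.
have [B KB Bcoord] := body_basis.
pose d (k : nat) : R := k%:R / (2 * n%:R) - 6.
exists (fun k : {ffun 'I_n -> 'I_(24 * n).+1} => (\row_i d (k i)) *m B) => w /Bcoord[c wE c2].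
pose k := [ffun i => inord (Num.truncn ((3 * c ord0 i + 6) * (2 * n%:R)))
                     : 'I_(24 * n).+1].
exists k.
have -> : w - (\row_i d (k i)) *m B =
          \sum_i (3 * c ord0 i - d (k i)) *: row i B.
  rewrite -[w](@scalerKV _ _ 3)//  wE scalemxAl -mulmxBl mulmx_sum_row.
  by apply: eq_bigr => i _; rewrite !mxE.
apply: le_trans (body_norm_sum Kbody _) _.
apply: (@le_trans _ _ (\sum_(i < n) (2 * n%:R)^-1)); last first.
  rewrite sumr_const card_ord -[leLHS]mulr_natl invfM mulrCA.
  have [->|n0] := eqVneq (n%:R : R) 0; first by rewrite mul0r mulr0 invr_ge0.
  by rewrite mulfV// mulr1.
apply: ler_sum => i _.
have n0 : (0 : R) < 2 * n%:R by rewrite mulr_gt0// ltr0n; case: n i => // -[].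
apply: le_trans (body_normZ_le Kbody _ _) _; rewrite -[leRHS]mulr1.
apply: ler_pM => //; [exact: body_norm_ge0 | | exact: body_norm_le1].
have [c6 c12] : 0 <= 3 * c ord0 i + 6 /\ 3 * c ord0 i + 6 <= 12.
  by have := c2 i; rewrite ler_norml => /andP[]; split; lra.
rewrite /d /k ffunE.
set t := _ * (2 * n%:R).
have t0 : 0 <= t by rewrite mulr_ge0// ltW.
rewrite inordK; last first.
  rewrite ltnS -(ler_nat R) natrM; have [/le_trans + _] := andP (truncn_itv t0).
  by apply; rewrite /t; nra.
have /andP[tl tr] := truncn_itv t0.
have -> : 3 * c ord0 i - ((Num.truncn t)%:R / (2 * n%:R) - 6) =
    (t - (Num.truncn t)%:R) / (2 * n%:R).
  by rewrite /t mulrBl mulfK ?gt_eqF//; ring.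
rewrite normrM [ `|_^-1|]gtr0_norm ?invr_gt0// -[leRHS]mul1r.
rewrite ler_pM2r ?invr_gt0// ger0_norm ?subr_ge0//.
by rewrite lerBlDr addrC -natr1 in tr *; lra.
Qed.

(** Go from x towards y, at most to the distance 5/2 t, up to a point u at
    distance at most s - t from y. A net of mesh t/2 provides a point near u, and
    this point moves by less than t/2 into the dense set D; the sum of the three
    distances is less than s. *)
Lemma cone_cover (D : set 'rV[R]_n) x t : dense D -> 0 < t ->
  exists z : {ffun 'I_n -> 'I_(24 * n).+1} -> 'rV[R]_n, (forall k, D (z k)) /\
  forall y s, t <= s -> N (x - y) <= s + 3 / 2 * t -> exists k, N (z k - y) < s.
Proof.
move=> dD t0; have [g gK] := body_net.
have /choice[z zP] : forall k, exists z, D z /\ N (z - (x + t *: g k)) < t / 2.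
  move=> k; have [] := dD [set z | N (z - (x + t *: g k)) < t / 2].
  - by exists (x + t *: g k); rewrite /= subrr body_norm0// divr_gt0.
  - exact: open_body_norm_lt.
  - by move=> z [zlt Dz]; exists z.
exists z; split => [k|y s ts Nxy]; first by case: (zP k).
(* The point of the segment from x to y that is nearest to y among those at
   distance at most 5/2 t from x. *)
have [u Nux Nuy] : exists2 u, N (u - x) <= 5 / 2 * t & N (u - y) <= s - t.
  have [d3|d3] := leP (N (x - y)) (5 / 2 * t).
    by exists y; rewrite ?subrr ?body_norm0 ?subr_ge0// body_norm_sub.
  have d0 : 0 < N (x - y) by lra.
  pose a := 5 / 2 * t / N (x - y).
  have a0 : 0 <= a by rewrite divr_ge0 ?ltW//; lra.
  have a1 : a <= 1 by rewrite ler_pdivrMr// mul1r ltW.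
  have aN : a * N (x - y) = 5 / 2 * t by rewrite divfK// gt_eqF.
  exists (x + a *: (y - x)).
    rewrite addrAC subrr add0r (le_trans (body_normZ_ge0 _ _ a0))//.
    by rewrite body_norm_sub// aN.
  have -> : x + a *: (y - x) - y = (1 - a) *: (x - y).
    by rewrite scalerBl scale1r -[y - x]opprB scalerN addrAC.
  rewrite (le_trans (body_normZ_ge0 _ _ _))// ?subr_ge0//.
  rewrite mulrBl mul1r aN; lra.
have [k kP] : exists k, N (t^-1 *: (u - x) - g k) <= 2^-1.
  apply: gK; rewrite scalerA -invfM; apply: body_norm_lt => //.
  by rewrite (le_lt_trans Nux)//; lra.
exists k; case: (zP k) => _ zk.
have Nzu : N (x + t *: g k - u) <= t / 2.
  have -> : x + t *: g k - u = t *: (- (t^-1 *: (u - x) - g k)).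
    rewrite opprB scalerBr scalerA divff ?gt_eqF// scale1r opprB.
    by rewrite addrCA addrA.
  rewrite (le_trans (body_normZ_ge0 _ _ (ltW t0)))// ler_pM2l// body_normN//.
have := body_norm_tri Kbody (z k) (x + t *: g k) y.
have := body_norm_tri Kbody (x + t *: g k) u y.
lra.
Qed.

End cone_covering.

(** * Null sets have a dense complement *)

Section lebesgue_outer_theory.
Context {R : realType}.

Lemma sum_lattice_le (M : nat) (u v : R) : u <= v ->
  \sum_(j < M) (u <= j%:R <= v)%R%:R <= v - u + 1.
Proof.
move=> uv; pose S (M : nat) : R := \sum_(j < M) (u <= j%:R <= v)%R%:R.
suff : S M = 0 \/ S M <= v - u + 1 /\ S M <= M%:R - u.
  by rewrite -/(S M) => -[->|[]//]; lra.
elim: M => [|M IH]; first by left; rewrite /S big_ord0.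
have -> : S M.+1 = S M + (u <= M%:R <= v)%R%:R by rewrite /S big_ord_recr.
rewrite -natr1; case: andP => [[uM Mv]|_]; last by rewrite addr0; lra.
by right; rewrite /= mulr1n; case: IH => [->|[]]; lra.
Qed.

Lemma prod_perturb {n} (c : 'I_n -> R) (e : R) : 0 < e ->
  exists2 d : R, 0 < d & \prod_(i < n) (c i + d) <= \prod_(i < n) c i + e.
Proof.
move=> e0; pose p := \prod_(i < n) ((c i)%:P + 'X).
have pE x : p.[x] = \prod_(i < n) (c i + x).
  by rewrite horner_prod; apply: eq_bigr => i _; rewrite !hornerE.
have /cvgrPdist_le/(_ _ e0)/nbhs_normP[d /= d0 dP] :=
  @continuous_horner _ p (0 : R).
exists (d / 2); rewrite ?divr_gt0// -pE.
have := dP (d / 2); rewrite /ball_/= sub0r normrN gtr0_norm ?divr_gt0//.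
rewrite ltr_pdivrMr// ltr_pMr// ltr1n => /(_ isT).
rewrite ler_distlC => /andP[_].
by rewrite [p.[0] in X in X -> _]pE; under [in X in X -> _]eq_bigr do rewrite addr0.
Qed.

Lemma sum_halves_le (m : nat) (e : R) : 0 <= e ->
  \sum_(k < m) e / 2 ^+ k.+1 <= e.
Proof.
move=> e0; suff -> : \sum_(k < m) e / 2 ^+ k.+1 = e - e / 2 ^+ m.
  by rewrite gerBl divr_ge0// exprn_ge0.
elim: m => [|m IH]; first by rewrite big_ord0 expr0 divr1 subrr.
rewrite big_ord_recr/= IH exprS invfM; set y := (2 ^+ m)^-1; lra.
Qed.

Lemma compact_box {n} (p q : 'rV[R]_n) : compact (box p q).
Proof.
have -> : box p q = [set v : 'rV[R]_n | forall i,
    `[p ord0 i, q ord0 i]%classic (v ord0 i)].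
  by apply/seteqP; split => v vpq i; have := vpq i; rewrite /= in_itv.
apply: (@rV_compact _ _ (fun i => `[p ord0 i, q ord0 i]%classic)) => i.
exact: segment_compact.
Qed.

Lemma finite_pos_lb (d : nat -> R) (m : nat) : (forall k, 0 < d k) ->
  exists2 r : R, 0 < r & forall k, (k < m)%N -> r <= d k.
Proof.
move=> d0; elim: m => [|m [r r0 rd]]; first by exists 1.
exists (Num.min r (d m)) => [|k]; first by rewrite lt_min r0 d0.
rewrite ltnS leq_eqVlt => /predU1P[->|/rd rk]; first by rewrite ge_min lexx orbT.
by rewrite ge_min rk.
Qed.

(** Counting the points of a grid. By compactness, finitely many slightly
    enlarged boxes of a cover contain the cube of side s, hence the M ^ n points of
    its grid of mesh s/M, while a box of sides h_i contains at most
    prod (h_i M/s + 1) of them. For large M this keeps the sum of the volumes above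
    s ^ n / 3. *)
Lemma lebesgue_outer_cube {n} (p q : 'rV[R]_n) (s : R) : 0 < s ->
  (forall i, q ord0 i = p ord0 i + s) -> lebesgue_outer (box p q) != 0%E.
Proof.
move=> s0 qE; apply/eqP => Q0.
pose e := s ^+ n / 3.
have e0 : 0 < e by rewrite divr_gt0// exprn_gt0.
have : (lebesgue_outer (box p q)  < e%:E)%E.
  by rewrite Q0 lte_fin.
case/ereal_inf_lt => _ [a [b [ab Qab ->]]] abe.
have vol0 k : 0 <= box_volume (a k) (b k).
  by apply: prodr_ge0 => i _; rewrite subr_ge0.
have /choice[d dP] k : exists d, 0 < d /\
    \prod_(i < n) (b k ord0 i - a k ord0 i + d) <=
    box_volume (a k) (b k) + e / 2 ^+ k.+1.
  have [|d d0 dP] := prod_perturb (fun i => b k ord0 i - a k ord0 i)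
    (_ : 0 < e / 2 ^+ k.+1); first by rewrite divr_gt0// exprn_gt0.
  by exists d.
have cQ : compact (box p q) by exact: compact_box.
pose U k := \bigcup_(y in box (a k) (b k)) ball y (d k / 4).
have [D _ QD] : finite_subset_cover setT U (box p q).
  move: cQ; rewrite compact_cover; apply.
    by move=> k _; apply: bigcup_open => y _; exact: ball_open.
  move=> x /Qab[k _ kx]; exists k => //; exists x => //; apply: ballxx.
  by rewrite divr_gt0//; case: (dP k).
pose m := (\max_(k <- enum_fset D) k).+1.
have Dm k : k \in D -> (k < m)%N by move=> kD; rewrite ltnS leq_bigmax_seq.
have [M M0 Md] : exists2 M : nat, (0 < M)%N & forall k, (k < m)%N -> s / M%:R <= d k / 2.
  have [r r0 rd] := finite_pos_lb m (fun k => (dP k).1).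
  exists (Num.truncn (2 * s / r)).+1 => // k /rd rk.
  have rs : 2 * s / r < (Num.truncn (2 * s / r)).+1%:R by exact: truncnS_gt.
  rewrite ler_pdivrMr ?ltr0n// mulrAC ler_pdivlMr//.
  rewrite ltr_pdivrMr// in rs.
  have T0 : (0 : R) < (Num.truncn (2 * s / r)).+1%:R by rewrite ltr0n.
  by move: rs T0; set T := _.+1%:R => rs T0; nra.
have M0R : (0 : R) < M%:R by rewrite ltr0n.
pose P k i (j : nat) : bool := (a k ord0 i - d k / 4 <= p ord0 i + s * (j%:R / M%:R) <=
                 b k ord0 i + d k / 4)%R.
have grid_cover : (M%:R ^+ n <= \sum_(k < m) \prod_(i < n) \sum_(j < M) (P k i j)%:R :> R).
  under [leRHS]eq_bigr do rewrite bigA_distr_bigA/=.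
  rewrite exchange_big/=.
  have -> : M%:R ^+ n = \sum_(f : {ffun 'I_n -> 'I_M}) (1 : R).
    by rewrite sumr_const card_ffun !card_ord natrX.
  apply: ler_sum => f _.
  have [] := QD (\row_i (p ord0 i + s * ((f i)%:R / M%:R))).
    move=> i; rewrite !mxE qE lerDl lerD2l mulr_ge0 ?divr_ge0 ?(ltW s0)//=.
    rewrite -[leRHS]mulr1 ler_wpM2l ?(ltW s0)// ler_pdivrMr// mul1r.
    by rewrite ler_nat ltnW.
  move=> k kD [y yk fy].
  rewrite (bigD1 (Ordinal (Dm k kD)))//= big1.
    rewrite lerDl; apply: sumr_ge0 => l _.
    by apply: prodr_ge0 => i _; rewrite ler0n.
  move=> i _; rewrite (_ : P k i (f i))//.
  case: fy => /= d0 /(_ ord0 i); rewrite mxE /ball/= ltr_distl => /andP[yl yr].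
  by have /andP[al br] := yk i; rewrite /P; apply/andP; split; lra.
have count k : (k < m)%N -> \prod_(i < n) \sum_(j < M) (P k i j)%:R <=
   (M%:R / s) ^+ n * \prod_(i < n) (b k ord0 i - a k ord0 i + d k).
  move=> km; rewrite -[n in _ ^+ n]card_ord -prodr_const -big_split/=.
  apply: ler_prod => i _; rewrite sumr_ge0//=.
  have dk := (dP k).1.
  have Ms0 : 0 < M%:R / s by rewrite divr_gt0.
  have PE j : P k i j = ((a k ord0 i - d k / 4 - p ord0 i) * (M%:R / s) <= j%:R
      <= (b k ord0 i + d k / 4 - p ord0 i) * (M%:R / s)).
    rewrite /P -[_ <= j%:R]ler_pdivlMr// -[j%:R <= _]ler_pdivrMr// invf_div.
    rewrite [s * (_ / _)]mulrCA; set x := j%:R * _.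
    by rewrite [_ - p ord0 i <= x]lerBlDl [x <= _]lerBrDl.
  under eq_bigr do rewrite PE.
  apply: le_trans (sum_lattice_le _ _) _.
    rewrite ler_wpM2r ?ltW//; have := ab k i; lra.
  rewrite -mulrBl mulrC -lerBrDl -mulrBr.
  have -> : b k ord0 i - a k ord0 i + d k - (b k ord0 i + d k / 4 - p ord0 i -
    (a k ord0 i - d k / 4 - p ord0 i)) = d k / 2 by field.
  rewrite -ler_pdivrMl// mulr1 invf_div.
  exact: Md.
have volm : \sum_(k < m) box_volume (a k) (b k) < e.
  rewrite -lte_fin (le_lt_trans _ abe)// -sumEFin.
  rewrite -(big_mkord xpredT (fun k => (box_volume (a k) (b k))%:E)).
  by apply: nneseries_lim_ge => k _ _; rewrite lee_fin.
have : s ^+ n <= \sum_(k < m) (box_volume (a k) (b k) + e / 2 ^+ k.+1).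
  rewrite -(ler_pM2l (exprn_gt0 n (divr_gt0 M0R s0))) -exprMn divfK ?gt_eqF//.
  rewrite (le_trans grid_cover)// mulr_sumr ler_sum// => k _.
  rewrite (le_trans (count _ (ltn_ord k)))//.
  by apply: ler_wpM2l (dP k).2; rewrite exprn_ge0// divr_ge0// ltW.
rewrite big_split/=; have := sum_halves_le m (ltW e0).
have := exprn_gt0 n s0; rewrite /e in volm *; lra.
Qed.

(** Otherwise the null set would contain a cube. *)
Lemma lebesgue_null_dense {n} (A : set 'rV[R]_n) :
  lebesgue_outer A = 0%E -> dense (~` A).
Proof.
move=> A0 O [x Ox] oO; apply: contrapT => /set0P/negP/negPn/eqP OA.
have /nbhs_normP[r /= r0 rO] : nbhs x O by exact: open_nbhs_nbhs.
pose q : 'rV[R]_n := \row_i (x ord0 i + r / 2).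
have qE i : q ord0 i = x ord0 i + r / 2 by rewrite mxE.
have /negP[] := lebesgue_outer_cube (divr_gt0 r0 (ltr0n _ 2)) qE.
have r2 : r / 2 < r by rewrite ltr_pdivrMr// ltr_pMr// ltr1n.
rewrite eq_le; apply/andP; split; last first.
  apply: le_ereal_inf_tmp => _ [a [b [ab _ ->]]].
  apply: nneseries_ge0 => k _ _; rewrite lee_fin.
  by apply: prodr_ge0 => i _; rewrite subr_ge0.
rewrite -A0; apply: ereal_inf_le_tmp => _ [a [b [ab Aab ->]]]; exists a, b.
split => // y yQ; apply: Aab.
have Oy : O y.
  apply: rO; rewrite /ball_/= (le_lt_trans _ r2)//; apply/rV_norm_leP => [|i].
    by rewrite divr_ge0// ltW.
  have := yQ i; rewrite !mxE => /andP[? ?]; rewrite ler_norml.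
  by apply/andP; split; lra.
by apply: contrapT => nAy; have : (O `&` ~` A) y by []; rewrite OA.
Qed.

(** In dimension 0 every box has volume 1, and the statement fails. *)
Lemma lebesgue_outer0 {n} : (0 < n)%N -> lebesgue_outer (set0 : set 'rV[R]_n) = 0%E.
Proof.
case: n => // n _; apply/eqP; rewrite eq_le; apply/andP; split.
  apply: ereal_inf_lbound; exists (fun=> 0), (fun=> 0); split => //.
  rewrite /box_volume eseries0// => k _ _.
  by rewrite big_ord_recl !mxE subrr mul0r.
apply: le_ereal_inf_tmp => _ [a [b [ab _ ->]]].
apply: nneseries_ge0 => k _ _; rewrite lee_fin.
by apply: prodr_ge0 => i _; rewrite subr_ge0.
Qed.

End lebesgue_outer_theory.

(** * Continuous functions with compact support *)

Section continuous_real_functions.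
Context {R : realType} {T : ptopologicalType}.
Implicit Types f g : T -> R.

Lemma continuous_fct_cst (a : R) : continuous (fun _ : T => a).
Proof. by move=> p; exact: cvg_cst. Qed.

Lemma continuous_fctD f g :
  continuous f -> continuous g -> continuous (fun p => f p + g p).
Proof. by move=> cf cg p; exact: (@cvgD _ _ _ (nbhs p) _ f g _ _ (cf p) (cg p)). Qed.

Lemma continuous_fctB f g :
  continuous f -> continuous g -> continuous (fun p => f p - g p).
Proof. by move=> cf cg p; exact: (@cvgB _ _ _ (nbhs p) _ f g _ _ (cf p) (cg p)). Qed.

Lemma continuous_fctM f g :
  continuous f -> continuous g -> continuous (fun p => f p * g p).
Proof. by move=> cf cg p; exact: (@continuousM _ _ f g p (cf p) (cg p)). Qed.

Lemma continuous_fct_min f g :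
  continuous f -> continuous g -> continuous (fun p => Num.min (f p) (g p)).
Proof. by move=> cf cg p; exact: continuous_min (cf p) (cg p). Qed.

Lemma continuous_fct_max f g :
  continuous f -> continuous g -> continuous (fun p => Num.max (f p) (g p)).
Proof. by move=> cf cg p; exact: continuous_max (cf p) (cg p). Qed.

Lemma continuous_fct_norm f : continuous f -> continuous (fun p => `|f p|).
Proof. by move=> cf p; exact: (@cvg_norm _ _ _ (nbhs p) _ f _ (cf p)). Qed.

Lemma continuous_fct_sum (F : nat -> T -> R) (N : nat) :
  (forall k, continuous (F k)) -> continuous (fun p => \sum_(k < N) F k p).
Proof.
move=> cF; elim: N => [|N IH].
  rewrite (_ : (fun _ => _) = (fun=> 0)); first exact: continuous_fct_cst.
  by apply/funext => p; rewrite big_ord0.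
rewrite (_ : (fun _ => _) = (fun p => \sum_(k < N) F k p + F N p)).
  exact: continuous_fctD.
by apply/funext => p; rewrite big_ord_recr.
Qed.

Lemma closed_fct_ge f (a : R) : continuous f -> closed [set p | a <= f p].
Proof.
move=> cf; have : closed (f @^-1` [set x | a <= x]).
  by apply: preimage_closed => [p _|]; [exact: cf|exact: closed_ge].
by [].
Qed.

Lemma open_fct_gt f (a : R) : continuous f -> open [set p | a < f p].
Proof.
move=> cf; have : open (f @^-1` [set x | a < x]).
  by apply: open_comp => [p _|]; [exact: cf|exact: open_gt].
by [].
Qed.

Lemma open_fct_lt f (a : R) : continuous f -> open [set p | f p < a].
Proof.
move=> cf; have : open (f @^-1` [set x | x < a]).
  by apply: open_comp => [p _|]; [exact: cf|exact: open_lt].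
by [].
Qed.

Lemma compact_pos_lb f (S : set T) : continuous f -> compact S ->
  (forall p, S p -> 0 < f p) -> exists2 d : R, 0 < d & forall p, S p -> d <= f p.
Proof.
move=> cf cS f0; have [->|/set0P S0] := eqVneq S set0; first by exists 1.
have [c /set_mem Sc fc] := compact_EVT_min S0 cS (continuous_subspaceT cf).
by exists (f c); [exact: f0|move=> p Sp; apply: fc; exact: mem_set].
Qed.

Lemma compact_bounded_fct f (S : set T) : continuous f -> compact S ->
  exists2 d : R, 0 < d & forall p, S p -> `|f p| <= d.
Proof.
move=> cf cS; have [->|/set0P S0] := eqVneq S set0; first by exists 1.
have cf' := continuous_fct_norm cf.
have [c /set_mem Sc fc] := compact_EVT_max S0 cS (continuous_subspaceT cf').
exists (`|f c| + 1) => [|p Sp]; first by rewrite ltr_wpDl.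
by rewrite (le_trans (fc p (mem_set Sp)))// lerDl.
Qed.

End continuous_real_functions.

Section compactly_supported.
Context {R : realType} {T : ptopologicalType}.
Implicit Types (f g : T -> R) (U S : set T) (V : nat -> set T).

Definition cc f := continuous f /\
  exists2 C : set T, compact C & forall p, f p != 0 -> C p.

Lemma cc_sub f g : cc f -> continuous g -> (forall p, f p = 0 -> g p = 0) -> cc g.
Proof.
move=> [_ [C cC fC]] cg fg; split => //; exists C => // p gp; apply: fC.
by apply: contra_neq gp; exact: fg.
Qed.

Lemma cc0 : cc (fun=> 0).
Proof.
split; first exact: continuous_fct_cst.
by exists set0; [exact: compact0|move=> p; rewrite eqxx].
Qed.

Lemma ccD f g : cc f -> cc g -> cc (fun p => f p + g p).
Proof.
move=> [cf [C cC fC]] [cg [D cD gD]]; split; first exact: continuous_fctD.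
exists (C `|` D); first exact: compactU.
move=> p fgp; have [fp|fp] := eqVneq (f p) 0; last by left; exact: fC.
by right; apply: gD; move: fgp; rewrite fp add0r.
Qed.

Lemma ccZ (a : R) f : cc f -> cc (fun p => a * f p).
Proof.
move=> cf; apply: (cc_sub cf) => [|p ->]; last by rewrite mulr0.
by apply: continuous_fctM; [exact: continuous_fct_cst|case: cf].
Qed.

Lemma cc_sum (F : nat -> T -> R) (N : nat) :
  (forall k, cc (F k)) -> cc (fun p => \sum_(k < N) F k p).
Proof.
move=> cF; elim: N => [|N IH].
  rewrite (_ : (fun _ => _) = (fun=> 0)); first exact: cc0.
  by apply/funext => p; rewrite big_ord0.
rewrite (_ : (fun _ => _) = (fun p => \sum_(k < N) F k p + F N p)).
  exact: ccD.
by apply/funext => p; rewrite big_ord_recr.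
Qed.

Lemma cc_bounded f : cc f -> exists2 M : R, 0 < M & forall p, `|f p| <= M.
Proof.
move=> [cf [C cC fC]]; have [M M0 fM] := compact_bounded_fct cf cC.
exists M => // p; have [->|/fC/fM//] := eqVneq (f p) 0.
by rewrite normr0 ltW.
Qed.

(** All that the representation theorem below uses of the topology; it replaces
    the Urysohn lemma and yields partitions of unity. *)
Definition open_bumps := forall U, open U -> exists phi : T -> R,
  [/\ continuous phi, forall p, 0 <= phi p <= 1 & forall p, 0 < phi p <-> U p].

Definition exhaustion V :=
  [/\ forall j, open (V j), forall i j, (i <= j)%N -> V i `<=` V j,
      forall p, exists j, V j p & forall j, exists2 C, compact C & V j `<=` C].

Lemma compact_exhaustion V S : exhaustion V -> compact S ->
  exists j, S `<=` V j.
Proof.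
move=> [oV Vmono Vcov _]; rewrite compact_cover => /(_ _ setT V).
case=> [i _|p _|D _ SD]; first exact: oV.
  by have [j Vj] := Vcov p; exists j.
exists (\max_(k <- enum_fset D) k) => p /SD[k kD] Vk.
by apply: Vmono Vk; exact: leq_bigmax_seq.
Qed.

End compactly_supported.

(** * The outer measure of a locally bounded functional *)

Section riesz.
Context {R : realType} {T : ptopologicalType}.
Hypothesis bumps : @open_bumps R T.

Definition linear_cc (l : (T -> R) -> R) := forall (a : R) f g, cc f -> cc g ->
  l (fun p => a * f p + g p) = a * l f + l g.

(** An upper bound suffices, for l (- f) = - l f. *)
Definition locally_bounded_cc (l : (T -> R) -> R) := forall C, compact C ->
  exists B : R, forall f, cc f -> (forall p, f p != 0 -> C p) ->
    (forall p, `|f p| <= 1) -> l f <= B.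

Definition test_fct (U : set T) (g : T -> R) :=
  [/\ cc g, forall p, 0 <= g p <= 1 & forall p, g p != 0 -> U p].

Section outer_measure.
Variable l : (T -> R) -> R.
Hypothesis l_lin : linear_cc l.
Hypothesis l_bnd : locally_bounded_cc l.
Local Open Scope ereal_scope.

Lemma lin_cc0 : l (fun=> 0%R) = 0%R.
Proof.
have := l_lin (-1)%R cc0 cc0; under eq_fun do rewrite mulr0 addr0.
by move=> ->; rewrite mulN1r addNr.
Qed.

Lemma lin_ccZ a f : cc f -> l (fun p => a * f p)%R = (a * l f)%R.
Proof.
move=> cf; rewrite -[RHS]addr0 -lin_cc0 -l_lin//; last exact: cc0.
by congr l; apply/funext => p; rewrite addr0.
Qed.

Lemma lin_ccD f g : cc f -> cc g -> l (fun p => f p + g p)%R = (l f + l g)%R.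
Proof.
move=> cf cg; rewrite -[l f]mul1r -l_lin//.
by congr l; apply/funext => p; rewrite mul1r.
Qed.

Lemma lin_cc_sum (F : nat -> T -> R) N : (forall k, cc (F k)) ->
  l (fun p => \sum_(k < N) F k p)%R = (\sum_(k < N) l (F k))%R.
Proof.
move=> cF; elim: N => [|N IH].
  by under eq_fun do rewrite big_ord0; rewrite big_ord0 lin_cc0.
under eq_fun do rewrite big_ord_recr/=.
by rewrite lin_ccD ?IH ?big_ord_recr//; exact: cc_sum.
Qed.

Lemma small_cc (f : T -> R) (e : R) : cc f -> (0 < e)%R ->
  exists2 r : R, (0 < r)%R & forall g, cc g -> (forall p, f p = 0 -> g p = 0)%R ->
    (forall p, `|g p| <= r)%R -> (l g <= e)%R.
Proof.
move=> [cf [C cC fC]] e0; have [B lB] := l_bnd cC.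
have B0 : (0 <= B)%R.
  rewrite -lin_cc0; apply: lB => [|p|p]; [exact: cc0| |].
    by rewrite eqxx.
  by rewrite normr0.
have r0 : (0 < e / (B + 1))%R by rewrite divr_gt0// ltr_wpDl.
exists (e / (B + 1))%R => // g cg fg gr.
have -> : g = (fun p => e / (B + 1) * ((e / (B + 1))^-1 * g p))%R.
  by apply/funext => p; rewrite mulVKf// gt_eqF.
rewrite lin_ccZ; last exact: ccZ.
apply: (@le_trans _ _ (e / (B + 1) * B)%R).
  apply: ler_wpM2l; first exact: ltW.
  apply: lB => [|p|p]; first exact: ccZ.
    move=> gp; apply: fC; apply: contra_neq gp => /fg ->.
    by rewrite mulr0.
  by rewrite normrM gtr0_norm ?invr_gt0// ler_pdivrMl// mulr1.
by rewrite mulrAC ler_pdivrMr ?ltr_wpDl// ler_pM2l// lerDl.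
Qed.

(** The mass of an open set: the variation of the positive part of the
    functional, read off the test functions of that set. *)
Definition open_mass (U : set T) : \bar R :=
  ereal_sup [set (l g)%:E | g in test_fct U].

Definition outer_mass (A : set T) : \bar R :=
  ereal_inf [set open_mass U | U in [set U | open U /\ A `<=` U]].

Lemma test_fct0 U : test_fct U (fun=> 0%R).
Proof. by split=> [|p|p]; [exact: cc0|rewrite lexx ler01|rewrite eqxx]. Qed.

Lemma open_mass_ge g U : test_fct U g -> (l g)%:E <= open_mass U.
Proof. by move=> gU; apply: ereal_sup_ubound; exists g. Qed.

Lemma open_mass_ge0 U : 0 <= open_mass U.
Proof. by have := open_mass_ge (test_fct0 U); rewrite lin_cc0. Qed.

Lemma open_mass_le U W : U `<=` W -> open_mass U <= open_mass W.
Proof.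
move=> UW; apply: ereal_sup_le => _ [g [cg g01 gU] <-]; exists g => //.
by split => // p /gU/UW.
Qed.

Lemma open_mass_lty U C : compact C -> U `<=` C -> open_mass U < +oo.
Proof.
move=> cC UC; have [B lB] := l_bnd cC.
apply: (@le_lt_trans _ _ B%:E); last exact: ltry.
apply: ge_ereal_sup => _ [g [cg g01 gU] <-]; rewrite lee_fin; apply: lB => //.
  by move=> p /gU/UC.
by move=> p; rewrite ger0_norm; case/andP: (g01 p).
Qed.

Lemma outer_mass_open U : open U -> outer_mass U = open_mass U.
Proof.
move=> oU; apply/eqP; rewrite eq_le; apply/andP; split.
  by apply: ereal_inf_lbound; exists U => //; split.
by apply: le_ereal_inf_tmp => _ [W [oW UW] <-]; exact: open_mass_le.
Qed.

(** A test function of a union is cut into test functions of the members by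
    peeling along truncated partial sums of the bumps; since a test function
    of U need not be supported compactly inside U, its small values are first
    cut off, which costs little by local boundedness. *)
Lemma open_mass_bigcup (U : nat -> set T) : (forall k, open (U k)) ->
  open_mass (\bigcup_k U k) <= \sum_(k <oo) open_mass (U k).
Proof.
move=> oU; apply: ge_ereal_sup => _ [g [cg g01 gU] <-].
apply/lee_addgt0Pr => e e0.
have [r r0 rP] := small_cc cg e0.
have /choice[phi phiP] := fun k => bumps (oU k).
have phi_ge0 k p : (0 <= phi k p)%R by have [_ /(_ p)/andP[]] := phiP k.
have [cgc [C cC gC]] := cg.
pose g' p := Num.max (g p - r)%R 0%R.
pose g'' p := Num.min (g p) r.
have cg' : cc g'.
  apply: (cc_sub cg) => [|p gp]; last first.
    by rewrite /g' gp sub0r max_r// oppr_le0 ltW.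
  apply: continuous_fct_max; last exact: continuous_fct_cst.
  by apply: continuous_fctB => //; exact: continuous_fct_cst.
have cg'' : cc g''.
  apply: (cc_sub cg) => [|p gp]; last by rewrite /g'' gp min_l// ltW.
  by apply: continuous_fct_min => //; exact: continuous_fct_cst.
have g'01 p : (0 <= g' p <= 1)%R.
  rewrite /g' le_max lexx orbT/= ge_max ler01 andbT.
  by have := g01 p; lra.
have gE : g = (fun p => g' p + g'' p)%R.
  apply/funext => p; rewrite /g' /g''; case: (leP (g p) r) => gr.
    by rewrite max_r ?add0r// subr_le0.
  by rewrite max_l ?subrK// subr_ge0 ltW.
rewrite [in leLHS]gE lin_ccD// EFinD; apply: leeD; last first.
  rewrite lee_fin; apply: rP => // p; first by move=> gp; rewrite /g'' gp min_l// ltW.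
  by rewrite /g'' ger0_norm ?le_min ?ge_min ?lexx ?orbT// (ltW r0) (andP (g01 p)).1.
pose S := [set p | (r <= g p)%R].
have cS : compact S.
  apply: (subclosed_compact _ cC); first exact: closed_fct_ge.
  by move=> p rg; apply: gC; rewrite gt_eqF// (lt_le_trans r0).
have [N SN] : exists N, forall p, S p -> exists2 k, (k < N)%N & U k p.
  move: (cS); rewrite compact_cover => /(_ _ setT U).
  case=> [k _|p /(lt_le_trans r0) gp|D _ SD]; first exact: oU.
    by apply: gU; rewrite gt_eqF.
  exists (\max_(k <- enum_fset D) k).+1 => p /SD[k kD] Uk; exists k => //.
  by rewrite ltnS; exact: leq_bigmax_seq.
pose sphi (k : nat) p := (\sum_(i < k) phi i p)%R.
have csphi k : continuous (sphi k).
  by apply: (@continuous_fct_sum R T phi k) => i; case: (phiP i).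
have [|d d0 Sd] := compact_pos_lb (csphi N) cS.
  move=> p /SN[k kN Uk]; rewrite /sphi (bigD1 (Ordinal kN))//=.
  apply: ltr_wpDr; first by apply: sumr_ge0 => i _; exact: phi_ge0.
  by case: (phiP k) => _ _ /(_ p)[_]; exact.
pose psi k p := Num.min 1%R (sphi k p / d)%R.
have psi_le k p : (psi k p <= psi k.+1 p)%R.
  rewrite /psi le_min ge_min lexx/= ge_min; apply/orP; right.
  by rewrite ler_pM2r ?invr_gt0// /sphi big_ord_recr/= lerDl.
have psi_ge0 k p : (0 <= psi k p)%R.
  by rewrite le_min ler01/= divr_ge0 ?(ltW d0)// sumr_ge0.
pose h k p := (g' p * (psi k.+1 p - psi k p))%R.
have cpsi k : continuous (psi k).
  apply: continuous_fct_min; first exact: continuous_fct_cst.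
  by apply: continuous_fctM => //; exact: continuous_fct_cst.
have ch k : cc (h k).
  apply: (cc_sub cg') => [|p gp]; last by rewrite /h gp mul0r.
  by apply: continuous_fctM; [case: cg'|exact: continuous_fctB].
have hE : g' = (fun p => \sum_(k < N) h k p)%R.
  apply/funext => p; rewrite -mulr_sumr.
  rewrite -(big_mkord xpredT (fun k => psi k.+1 p - psi k p)%R).
  rewrite telescope_sumr//.
  have -> : psi 0%N p = 0%R.
    by rewrite /psi /sphi big_ord0 mul0r min_r.
  rewrite subr0; case: (leP r (g p)) => rg.
    by rewrite /psi min_l ?mulr1// ler_pdivlMr// mul1r Sd.
  by rewrite /g' max_r ?mul0r// subr_le0 ltW.
rewrite hE lin_cc_sum// -sumEFin.
apply: le_trans (_ : \sum_(k < N) open_mass (U k) <= _).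
  apply: lee_sum => k _; apply: open_mass_ge; split => // p.
    have /andP[g0 g1] := g'01 p.
    rewrite /h mulr_ge0 ?subr_ge0//= mulr_ile1 ?subr_ge0//.
    rewrite lerBlDr (le_trans (_ : _ <= 1)%R)//; first by rewrite ge_min lexx.
    by rewrite lerDl.
  move=> hp; have [_ _ /(_ p)[+ _]] := phiP k; apply.
  rewrite lt_neqAle phi_ge0 andbT; apply: contra_neq hp => phi0.
  by rewrite /h /psi /sphi big_ord_recr/= -phi0 addr0 subrr mulr0.
rewrite -(big_mkord xpredT (fun k => open_mass (U k))).
by apply: nneseries_lim_ge => k _ _; exact: open_mass_ge0.
Qed.

Lemma outer_mass0 : outer_mass set0 = 0.
Proof.
rewrite outer_mass_open; last exact: open0.
apply/eqP; rewrite eq_le open_mass_ge0 andbT.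
apply: ge_ereal_sup => _ [g [_ _ g0] <-]; rewrite lee_fin -lin_cc0.
suff -> : g = (fun=> 0%R) by [].
by apply/funext => p; apply: contrapT => /eqP/g0.
Qed.

Lemma outer_mass_ge0 A : 0 <= outer_mass A.
Proof. by apply: le_ereal_inf_tmp => _ [U _ <-]; exact: open_mass_ge0. Qed.

Lemma le_outer_mass : {homo outer_mass : A B / A `<=` B >-> A <= B}.
Proof.
move=> A B AB; apply: ereal_inf_le_tmp => _ [U [oU BU] <-]; exists U => //.
by split => //; exact: subset_trans BU.
Qed.

Lemma outer_mass_adherent A (e : R) : (0 < e)%R ->
  exists U, [/\ open U, A `<=` U & open_mass U <= outer_mass A + e%:E].
Proof.
move=> e0; have [Afin|] := boolP (outer_mass A \is a fin_num).
  have [_ [U [oU AU] <-] /ltW Ue] := lb_ereal_inf_adherent e0 Afin.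
  by exists U.
rewrite ge0_fin_numE ?outer_mass_ge0// -leNgt leye_eq => /eqP ->.
by exists setT; split => //; [exact: openT|rewrite addye// leey].
Qed.

Lemma outer_mass_sigma_subadditive : sigma_subadditive outer_mass.
Proof.
move=> A; apply/lee_addgt0Pr => e e0.
have /choice[U UP] : forall k, exists U, [/\ open U, A k `<=` U &
    open_mass U <= outer_mass (A k) + (e / (2 ^ k.+1)%:R)%:E].
  by move=> k; apply: outer_mass_adherent; rewrite divr_gt0// ltr0n expn_gt0.
have oU k : open (U k) by case: (UP k).
apply: le_trans (epsilon_trick xpredT (fun k => outer_mass_ge0 (A k)) (ltW e0)).
apply: (@le_trans _ _ (open_mass (\bigcup_k U k))).
  apply: ereal_inf_lbound; exists (\bigcup_k U k) => //; split.
    by apply: bigcup_open => k _.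
  by apply: subset_bigcup => k _; case: (UP k).
apply: le_trans (open_mass_bigcup oU) _; apply: lee_nneseries => k _ => [_|].
  exact: open_mass_ge0.
by case: (UP k).
Qed.

HB.instance Definition _ := isOuterMeasure.Build R T outer_mass
  outer_mass0 outer_mass_ge0 le_outer_mass outer_mass_sigma_subadditive.

(** If g tests the part of W in U, a test function h of the part of W where g
    is less than e can be added to it up to the factor 1 - e. *)
Lemma open_caratheodory U : open U -> outer_mass.-caratheodory U.
Proof.
move=> oU; apply: le_caratheodory_measurable => X.
apply: le_ereal_inf_tmp => _ [W [oW XW] <-].
have [Wfin|] := boolP (open_mass W \is a fin_num); last first.
  by rewrite ge0_fin_numE ?open_mass_ge0// -leNgt leye_eq => /eqP ->; rewrite leey.
apply: (@le_trans _ _ (open_mass (W `&` U) + outer_mass (W `&` ~` U))).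
  apply: leeD; last by apply: le_outer_mass; exact: setSI.
  rewrite -outer_mass_open; last exact: openI.
  by apply: le_outer_mass; exact: setSI.
have WUfin : outer_mass (W `&` ~` U) \is a fin_num.
  rewrite ge0_fin_numE ?outer_mass_ge0//.
  rewrite (@le_lt_trans _ _ (open_mass W))//; last by rewrite ltey_eq Wfin.
  by rewrite -outer_mass_open//; apply: le_outer_mass; exact: subIsetl.
rewrite -leeBrDr//; apply: ge_ereal_sup => _ [g [cg g01 gWU] <-].
rewrite leeBrDr// -(fineK WUfin) -(fineK Wfin) -EFinD lee_fin.
set x := fine _; set w := fine _.
have key e : (0 < e < 1)%R -> (l g + (1 - e) * x <= w)%R.
  move=> /andP[e0 e1]; have e1' : (0 < 1 - e)%R by rewrite subr_gt0.
  rewrite addrC -lerBrDr -ler_pdivlMl// -lee_fin fineK//.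
  pose W' := W `&` [set p | (g p < e)%R].
  have oW' : open W' by apply: openI => //; apply: open_fct_lt; case: cg.
  apply: (@le_trans _ _ (open_mass W')).
    rewrite -outer_mass_open//; apply: le_outer_mass => p [Wp Up]; split => //=.
    have -> // : g p = 0%R.
    by apply: contra_notP Up => /eqP/gWU[].
  apply: ge_ereal_sup => _ [h [ch h01 hW'] <-].
  rewrite lee_fin ler_pdivlMl// lerBrDr -l_lin// -lee_fin /w fineK//.
  apply: open_mass_ge; split => [|p|p].
  - by apply: ccD => //; exact: ccZ.
  - have /andP[h0 h1] := h01 p; have /andP[g0 g1] := g01 p.
    rewrite addr_ge0 ?mulr_ge0 ?(ltW e1')//=.
    have [->|/hW'[_ /= ge]] := eqVneq (h p) 0%R; first by rewrite mulr0 add0r.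
    by nra.
  - have [->|/hW'[]//] := eqVneq (h p) 0%R.
    by rewrite mulr0 add0r => /gWU[].
have [x0|x0] := leP x 0%R.
  have : (0 < 2^-1 :> R)%R && (2^-1 < 1 :> R)%R by apply/andP; split; lra.
  by move=> /key; nra.
apply/ler_addgt0Pr => e e0.
pose d := Num.min 2^-1%R (e / x)%R.
have d0 : (0 < d)%R by rewrite lt_min invr_gt0 ltr0n divr_gt0.
have d1 : (d < 1)%R by rewrite gt_min; apply/orP; left; lra.
have dx : (d * x <= e)%R by rewrite -ler_pdivlMr// ge_min lexx orbT.
have := key d; rewrite d0 d1 => /(_ isT); nra.
Qed.

(** The hypotheses are arguments, so that the structure of a measure can be
    attached to the function. *)
Definition riesz_measure
    of @open_bumps R T & linear_cc l & locally_bounded_cc l :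
  set (g_sigma_algebraType (@open T)) -> \bar R := outer_mass.

Local Notation P := (riesz_measure bumps l_lin l_bnd).

Let borel_caratheodory (A : set (g_sigma_algebraType (@open T))) :
  measurable A -> outer_mass.-caratheodory A.
Proof.
have := @smallest_sub _ _ (@open T) _
  (sigma_algebra_measurable (caratheodory_type outer_mass)).
by apply=> U; exact: open_caratheodory.
Qed.

Let riesz0 : P set0 = 0. Proof. exact: outer_mass0. Qed.

Let riesz_ge0 A : 0 <= P A. Proof. exact: outer_mass_ge0. Qed.

Let riesz_sigma_additive : semi_sigma_additive P.
Proof.
move=> F mF tF mUF; apply: caratheodory_measure_sigma_additive => //.
  by move=> i; exact: borel_caratheodory.
exact: borel_caratheodory.
Qed.

HB.instance Definition _ := isMeasure.Build _ _ _ P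
  riesz0 riesz_ge0 riesz_sigma_additive.

Lemma riesz_measure_open U : open U -> P U = open_mass U.
Proof. exact: outer_mass_open. Qed.

Lemma riesz_measure_lty (A C : set T) :
  open A -> compact C -> A `<=` C -> P A < +oo.
Proof. by move=> oA cC AsC; rewrite riesz_measure_open//; exact: (open_mass_lty cC). Qed.

End outer_measure.
End riesz.

(** * Layers of a function and integrals *)

Section borel_measures.
Context {R : realType} {T : ptopologicalType}.
Local Notation B := (g_sigma_algebraType (@open T)).

Lemma open_measurable_borel (U : set B) : open (U : set T) -> measurable U.
Proof. by move=> oU; exact: sub_sigma_algebra. Qed.

Lemma continuous_measurable_borel (f : B -> R) :
  continuous (f : T -> R) -> measurable_fun setT f.
Proof.
move=> cf.
apply: (measurability _ (measurable_realfun.RGenOInfty.measurableE R)).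
move=> _ [_ [x ->] <-]; rewrite setTI; apply: open_measurable_borel.
have -> : f @^-1` `]x, +oo[ = [set p | x < f p].
  by apply/seteqP; split => p /=; rewrite in_itv/= andbT.
exact: open_fct_gt.
Qed.

End borel_measures.

Section slicing.
Context {R : realType}.

(** Clamping x - k to the unit interval cuts a nonnegative x into slices. *)
Definition slice (x : R) (k : nat) : R := Num.min (Num.max (x - k%:R) 0) 1.

Lemma slice_itv x k : 0 <= slice x k <= 1.
Proof.
by rewrite /slice le_min le_max lexx orbT ler01/= ge_min lexx orbT.
Qed.

Lemma slice_eq0 x k : x <= k%:R -> slice x k = 0.
Proof. by move=> xk; rewrite /slice max_r ?subr_le0// min_l. Qed.

Lemma slice_eq1 x k : k.+1%:R <= x -> slice x k = 1.
Proof.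
rewrite -natr1 => kx; have kx1 : 1 <= x - k%:R by lra.
by rewrite /slice min_r// le_max kx1.
Qed.

Lemma sum_slice x N : 0 <= x -> \sum_(k < N) slice x k = Num.min x N%:R.
Proof.
move=> x0; elim: N => [|N IH]; first by rewrite big_ord0 min_r.
rewrite big_ord_recr/= IH; have [xN|Nx] := leP x N%:R.
  by rewrite slice_eq0// addr0 min_l// -natr1; lra.
rewrite /slice max_l ?subr_ge0 ?(ltW Nx)// -natr1.
have [xN|xN] := leP (x - N%:R) 1.
  by rewrite [RHS]min_l; lra.
by rewrite [RHS]min_r; lra.
Qed.

Lemma slice_le x k : slice x k <= (k%:R < x)%R%:R.
Proof.
have [kx|kx] := ltP k%:R x; last by rewrite slice_eq0.
by case/andP: (slice_itv x k).
Qed.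

Lemma slice_ge x k : (k.+1%:R < x)%R%:R <= slice x k.
Proof.
have [kx|kx] := ltP k.+1%:R x; first by rewrite slice_eq1// ltW.
by case/andP: (slice_itv x k).
Qed.

End slicing.

Section layer_cake.
Context {R : realType} {T : ptopologicalType}.
Local Notation B := (g_sigma_algebraType (@open T)).
Variable m : {measure set B -> \bar R}.

Lemma sum_level_ge (x : R) N : 0 <= x <= N%:R ->
  x <= \sum_(k < N) (k%:R < x)%R%:R.
Proof.
move=> /andP[x0 xN]; rewrite -{1}(min_l xN) -sum_slice//.
by apply: ler_sum => k _; exact: slice_le.
Qed.

Lemma sum_level_le (x : R) M : 0 <= x ->
  \sum_(k < M.+1) (k%:R < x)%R%:R <= (0 < x)%R%:R + x.
Proof.
move=> x0; rewrite big_ord_recl/= lerD2l.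
apply: (@le_trans _ _ (\sum_(k < M) slice x k)).
  by apply: ler_sum => k _; exact: slice_ge.
by rewrite sum_slice// ge_min lexx.
Qed.

Local Open Scope ereal_scope.

Section levels.
Variables (f : B -> R) (a : R).
Hypothesis cf : continuous (f : T -> R).
Local Notation W k := ([set p | (k%:R < a * f p)%R] : set B).

Let mW k : measurable (W k).
Proof.
apply: open_measurable_borel; apply: open_fct_gt.
by apply: continuous_fctM => //; exact: continuous_fct_cst.
Qed.

Let sum_levelE N p : (\sum_(k < N) (k%:R < a * f p)%R%:R)%:E =
  \sum_(k < N) (\1_(W k) p)%:E :> \bar R.
Proof.
rewrite -sumEFin; apply: eq_bigr => k _; rewrite indicE; congr (_%:R%:E).
by congr nat_of_bool; apply/idP/idP => [kp|/set_mem//]; exact: mem_set.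
Qed.

Lemma measurable_sum_level N :
  measurable_fun setT ((fun p => (\sum_(k < N) (k%:R < a * f p)%R%:R)%:E) : B -> \bar R).
Proof.
under eq_fun do rewrite sum_levelE; apply: emeasurable_sum => k.
by apply/measurable_EFinP; exact: measurable_indic.
Qed.

Lemma integral_sum_level N :
  \int[m]_p (\sum_(k < N) (k%:R < a * f p)%R%:R)%:E = \sum_(k < N) m (W k).
Proof.
under eq_integral do rewrite sum_levelE.
rewrite ge0_integral_sum//; last first.
  by move=> k; apply/measurable_EFinP; exact: measurable_indic.
by apply: eq_bigr => k _; rewrite integral_indic// setIT.
Qed.

End levels.

Variable f : B -> R.
Hypotheses (cf : continuous (f : T -> R)) (f0 : forall p, (0 <= f p)%R).
Local Notation W N k := ([set p | (k%:R < N%:R * f p)%R] : set B).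

Let mf : measurable_fun setT ((fun p => (f p)%:E) : B -> \bar R).
Proof. by apply/measurable_EFinP; exact: continuous_measurable_borel. Qed.

(** The number of integers k >= 0 with k < x differs from x by at most 1. For
    x = N * f p, this compares N times the integral of f with the masses of the N
    level sets, which are open, up to an error that does not depend on N. *)
Lemma layer_cake_le N : (forall p, (f p <= 1)%R) ->
  N%:R%:E * \int[m]_p (f p)%:E <= \sum_(k < N) m (W N k).
Proof.
move=> f1; rewrite -integral_sum_level// -ge0_integralZl// ?lee_fin//; last first.
  by move=> p _; rewrite lee_fin.
apply: ge0_le_integral => //.
- by move=> p _; rewrite -EFinM lee_fin mulr_ge0.
- exact: measurable_funeM.
- exact: measurable_sum_level.
- move=> p _; rewrite -EFinM lee_fin; apply: sum_level_ge.
  by rewrite mulr_ge0//= -[leRHS]mulr1 ler_wpM2l.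
Qed.

Lemma layer_cake_ge M : \sum_(k < M.+1) m (W M.+1 k) <=
  m (W M.+1 0%N) + M.+1%:R%:E * \int[m]_p (f p)%:E.
Proof.
rewrite -integral_sum_level// -ge0_integralZl// ?lee_fin//; last first.
  by move=> p _; rewrite lee_fin.
have -> : m (W M.+1 0%N) = \int[m]_p (\sum_(k < 1) (k%:R < M.+1%:R * f p)%R%:R)%:E.
  by rewrite integral_sum_level// big_ord1.
rewrite -ge0_integralD//.
- apply: ge0_le_integral => //.
  + by move=> p _; rewrite lee_fin sumr_ge0.
  + exact: measurable_sum_level.
  + by apply: emeasurable_funD; [exact: measurable_sum_level|exact: measurable_funeM].
  + move=> p _; rewrite big_ord1 -EFinM -EFinD lee_fin; apply: sum_level_le.
    by rewrite mulr_ge0.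
- by move=> p _; rewrite lee_fin sumr_ge0.
- exact: measurable_sum_level.
- by move=> p _; rewrite -EFinM lee_fin mulr_ge0.
- exact: measurable_funeM.
Qed.

End layer_cake.

(** * Integral representation of locally bounded functionals *)

Section riesz_representation.
Context {R : realType} {T : ptopologicalType}.
Hypothesis bumps : @open_bumps R T.
Local Notation B := (g_sigma_algebraType (@open T)).
Local Open Scope ereal_scope.

Definition locally_finite (m : set B -> \bar R) := forall U C : set T,
  open U -> compact C -> U `<=` C -> m U < +oo.

Lemma locally_finite_level (m : {measure set B -> \bar R}) (f : T -> R) N k :
  locally_finite m -> cc f ->
  m [set p | (k%:R < N%:R * f p)%R] \is a fin_num.
Proof.
move=> mfin [cf [C cC fC]]; rewrite ge0_fin_numE//; apply: mfin cC _.
  by apply: open_fct_gt; apply: continuous_fctM => //; exact: continuous_fct_cst.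
move=> p /= kf; apply: fC; apply: contraTneq kf => ->.
by rewrite mulr0 -leNgt ler0n.
Qed.

Lemma integral_cc_fin_num (m : {measure set B -> \bar R}) (f : T -> R) :
  locally_finite m -> cc f -> (forall p, 0 <= f p <= 1)%R ->
  \int[m]_p (f p)%:E \is a fin_num.
Proof.
move=> mfin cf f01; have f0 p : (0 <= f p)%R by case/andP: (f01 p).
rewrite ge0_fin_numE; last by apply: integral_ge0 => p _; rewrite lee_fin.
have := @layer_cake_le _ _ m f (proj1 cf) f0 1.
rewrite mul1e big_ord1 => /(_ (fun p => (andP (f01 p)).2))/le_lt_trans; apply.
by rewrite -ge0_fin_numE// locally_finite_level.
Qed.

Lemma le_of_archimedean (x y w : R) : (0 <= w)%R ->
  (forall M, M.+1%:R * x <= w + M.+1%:R * y)%R -> (x <= y)%R.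
Proof.
move=> w0 xy; apply/ler_addgt0Pr => e e0.
have := xy (Num.truncn (w / e)); have := truncnS_gt (w / e).
rewrite ltr_pdivrMr//; set N := (_.+1)%:R => wN.
have N0 : (0 < N :> R)%R by rewrite ltr0n.
move=> Nxy.
by rewrite -(ler_pM2l N0) (le_trans Nxy)// mulrDr addrC lerD2l ltW.
Qed.

Section half.
Variable l : (T -> R) -> R.
Hypotheses (l_lin : linear_cc l) (l_bnd : locally_bounded_cc l).
Local Notation P := (riesz_measure bumps l_lin l_bnd).

Lemma riesz_locally_finite : locally_finite P.
Proof. by move=> U C oU cC UC; exact: riesz_measure_lty cC UC. Qed.

Variable f : T -> R.
Hypotheses (cf : cc f) (f01 : forall p, (0 <= f p <= 1)%R).
Let f0 p : (0 <= f p)%R. Proof. by case/andP: (f01 p). Qed.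
Let Ifin := integral_cc_fin_num riesz_locally_finite cf f01.
Local Notation W N k := ([set p | (k%:R < N%:R * f p)%R] : set B).
Let Wfin N k : P (W N k) \is a fin_num := locally_finite_level N k riesz_locally_finite cf.
Let W0E M : W M.+1 0%N = [set p | (0 < f p)%R].
Proof. by apply/seteqP; split => p /=; rewrite pmulr_rgt0. Qed.

Let oW N k : open (W N k : set T).
Proof.
apply: open_fct_gt; apply: continuous_fctM; [exact: continuous_fct_cst|].
by case: cf.
Qed.

Let cslice N k : cc (fun p => slice (N%:R * f p) k).
Proof.
have [fc _] := cf; apply: (cc_sub cf) => [|p ->]; last first.
  by rewrite mulr0 slice_eq0.
apply: continuous_fct_min; last exact: continuous_fct_cst.
apply: continuous_fct_max; last exact: continuous_fct_cst.
apply: continuous_fctB; last exact: continuous_fct_cst.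
by apply: continuous_fctM => //; exact: continuous_fct_cst.
Qed.

(** The slices of N * f are test functions of the level sets of N * f. *)
Lemma lin_le_integral : (l f)%:E <= \int[P]_p (f p)%:E.
Proof.
rewrite -(fineK Ifin) lee_fin.
apply: (@le_of_archimedean _ _ (fine (P [set p | (0 < f p)%R]))).
  exact: fine_ge0.
move=> M; rewrite -lin_ccZ//.
have -> : (fun p => M.+1%:R * f p)%R =
    (fun p => \sum_(k < M.+1) slice (M.+1%:R * f p) k)%R.
  apply/funext => p; rewrite sum_slice ?mulr_ge0// min_l//.
  by rewrite -[leRHS]mulr1 ler_wpM2l//; case/andP: (f01 p).
rewrite (lin_cc_sum l_lin (F := fun k p => slice (M.+1%:R * f p) k))//.
rewrite -lee_fin EFinD EFinM (fineK Ifin) -(W0E M) fineK//.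
apply: le_trans (layer_cake_ge _ (proj1 cf) f0 M).
rewrite -sumEFin; apply: lee_sum => k _.
rewrite -[leRHS]/(P (W M.+1 k)) riesz_measure_open//.
apply: open_mass_ge; split => // p; first exact: slice_itv.
by apply: contraNP => /negP; rewrite -leNgt => /slice_eq0 ->.
Qed.

(** Test functions that nearly attain the masses of the level sets of N * f add
    up to N * g with g <= f: the k-th of them vanishes where the k-th slice of
    N * f is less than 1. *)
Lemma integral_le_lin (e : R) : (0 < e)%R -> exists g : T -> R,
  [/\ cc g, forall p, (0 <= g p <= f p)%R & \int[P]_p (f p)%:E <= (l g + e)%:E].
Proof.
move=> e0; pose w := fine (P [set p | (0 < f p)%R]).
have w0 : (0 <= w)%R by exact: fine_ge0.
pose M := Num.truncn (w / (e / 2)); have := truncnS_gt (w / (e / 2)).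
rewrite -/M ltr_pdivrMr ?divr_gt0// => wM.
have M0 : (0 < M.+1%:R :> R)%R by rewrite ltr0n.
have /choice[g gP] : forall k, exists g, test_fct (W M.+1 k.+1) g /\
    P (W M.+1 k.+1) <= (l g + e / 2)%:E.
  move=> k; have := Wfin M.+1 k.+1; rewrite riesz_measure_open// => Wk.
  have [_ [g gW <-] /ltW] := ub_ereal_sup_adherent (divr_gt0 e0 (ltr0n R 2)) Wk.
  by rewrite leeBlDr// -EFinD; exists g.
have cg k : cc (g k) by case: (gP k) => -[].
have g01 k p : (0 <= g k p <= 1)%R by case: (gP k) => -[].
exists (fun p => M.+1%:R^-1 * \sum_(k < M) g k p)%R; split.
- by apply: ccZ; exact: cc_sum.
- move=> p; rewrite mulr_ge0 ?invr_ge0 ?(ltW M0)//=; last first.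
    by apply: sumr_ge0 => k _; case/andP: (g01 k p).
  rewrite ler_pdivrMl//.
  apply: (@le_trans _ _ (\sum_(k < M) slice (M.+1%:R * f p) k)%R).
    apply: ler_sum => k _; apply: le_trans (slice_ge _ _).
    case: (gP k) => -[_ _ gW] _.
    have [->|/gW/= ->] := eqVneq (g k p) 0%R; first by rewrite ler0n.
    by case/andP: (g01 k p).
  by rewrite sum_slice ?mulr_ge0// ge_min lexx.
- rewrite (lin_ccZ l_lin); last exact: cc_sum.
  rewrite (lin_cc_sum l_lin)// -(fineK Ifin) lee_fin -(ler_pM2l M0) mulrDr mulVKf ?gt_eqF//.
  have f1 p : (f p <= 1)%R by case/andP: (f01 p).
  have wE : w%:E = P (W M.+1 0%N) by rewrite /w -(W0E M) fineK.
  have Ile : M.+1%:R%:E * (fine (\int[P]_p (f p)%:E))%:E <=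
      w%:E + \sum_(k < M) P (W M.+1 k.+1).
    rewrite wE fineK//; have := layer_cake_le P (proj1 cf) f0 M.+1 f1.
    by rewrite big_ord_recl.
  rewrite -lee_fin EFinM (le_trans Ile)//.
  apply: (@le_trans _ _ (w%:E + \sum_(k < M) (l (g k) + e / 2)%:E)).
    by apply: leeD => //; apply: lee_sum => k _; case: (gP k).
  rewrite sumEFin -EFinD lee_fin big_split/= sumr_const card_ord -[in leLHS]mulr_natl.
  rewrite addrCA lerD2l (le_trans (lerD (ltW wM) (lexx _)))//.
  by rewrite -natr1; have := mulr_ge0 (ler0n R M) (ltW e0); lra.
Qed.

End half.

Lemma integral_le_cc (m : {measure set B -> \bar R}) (f g : T -> R) :
  cc f -> cc g -> (forall p, 0 <= g p <= f p)%R ->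
  \int[m]_p (g p)%:E <= \int[m]_p (f p)%:E.
Proof.
move=> [cf _] [cg _] gf; apply: ge0_le_integral => //.
- by move=> p _; rewrite lee_fin; case/andP: (gf p).
- by apply/measurable_EFinP; exact: continuous_measurable_borel.
- by apply/measurable_EFinP; exact: continuous_measurable_borel.
- by move=> p _; rewrite lee_fin; case/andP: (gf p).
Qed.

(** Subtracting from f a function g on which the functional nearly attains the
    integral of f, what remains is estimated by the opposite functional. *)
Lemma riesz_half l l' (l_lin : linear_cc l) (l_bnd : locally_bounded_cc l)
  (l'_lin : linear_cc l') (l'_bnd : locally_bounded_cc l') f :
  (forall f, l' f = - l f)%R -> cc f -> (forall p, 0 <= f p <= 1)%R ->
  (fine (\int[riesz_measure bumps l_lin l_bnd]_p (f p)%:E) -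
   fine (\int[riesz_measure bumps l'_lin l'_bnd]_p (f p)%:E) <= l f)%R.
Proof.
move=> ll' cf f01.
have Pfin := integral_cc_fin_num (riesz_locally_finite l_lin l_bnd) cf f01.
have Qfin := integral_cc_fin_num (riesz_locally_finite l'_lin l'_bnd) cf f01.
apply/ler_addgt0Pr => e /(integral_le_lin l_lin l_bnd cf f01)[g [cg g0f]].
rewrite -(fineK Pfin) lee_fin => Plg.
have cfg : cc (fun p => f p - g p)%R.
  have := ccD cf (ccZ (-1)%R cg); congr cc.
  by apply/funext => p; rewrite mulN1r.
have fg01 p : (0 <= f p - g p <= 1)%R.
  by have := g0f p; have := f01 p; lra.
have := lin_le_integral l'_lin l'_bnd cfg fg01.
have -> : l' (fun p => f p - g p)%R = (l g - l f)%R.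
  rewrite ll' -opprB; congr (- _)%R; rewrite -[(- l g)%R]mulN1r -lin_ccZ//.
  by rewrite -lin_ccD//; [congr l; apply/funext => p; rewrite mulN1r|exact: ccZ].
move=> /le_trans/(_ (integral_le_cc _ cf cfg _)).
rewrite -(fineK Qfin) lee_fin.
have h p : (0 <= f p - g p <= f p)%R by have := g0f p; lra.
by move=> /(_ h); lra.
Qed.

Lemma riesz_cc01 l l' (l_lin : linear_cc l) (l_bnd : locally_bounded_cc l)
  (l'_lin : linear_cc l') (l'_bnd : locally_bounded_cc l') f :
  (forall f, l' f = - l f)%R -> cc f -> (forall p, 0 <= f p <= 1)%R ->
  l f = (fine (\int[riesz_measure bumps l_lin l_bnd]_p (f p)%:E) -
   fine (\int[riesz_measure bumps l'_lin l'_bnd]_p (f p)%:E))%R.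
Proof.
move=> ll' cf f01; apply/eqP; rewrite eq_le riesz_half// andbT.
have l'l g : l g = (- l' g)%R by rewrite ll' opprK.
by have := riesz_half l'_lin l'_bnd l_lin l_bnd l'l cf f01; rewrite ll'; lra.
Qed.
End riesz_representation.

(** * Integration of compactly supported functions *)

Section locally_finite_integral.
Context {R : realType} {T : ptopologicalType}.
Local Notation B := (g_sigma_algebraType (@open T)).
Local Open Scope ereal_scope.

Lemma cc_integrable (m : {measure set B -> \bar R}) (f : T -> R) :
  locally_finite m -> cc f -> m.-integrable setT (EFin \o (f : B -> R)).
Proof.
move=> mfin cf; have [M M0 fM] := cc_bounded cf.
have cf' := proj1 cf; have cnf : continuous (fun p => `|f p|)%R.
  by move=> p; exact: (@cvg_norm _ _ _ (nbhs p) _ f _ (cf' p)).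
apply/integrableP; split.
  by apply/measurable_EFinP; exact: continuous_measurable_borel.
have cg : cc (fun p => M^-1 * `|f p|)%R.
  apply: (cc_sub cf) => [|p ->]; last by rewrite normr0 mulr0.
  by apply: continuous_fctM => //; exact: continuous_fct_cst.
have g01 p : (0 <= M^-1 * `|f p| <= 1)%R.
  by rewrite mulr_ge0 ?invr_ge0 ?(ltW M0)//= ler_pdivrMl// mulr1.
have := integral_cc_fin_num mfin cg g01.
rewrite (_ : (fun p => _) = (fun p => M^-1%:E * (`|f p|)%:E)); last first.
  by apply/funext => p; rewrite EFinM.
rewrite ge0_integralZl//; last 2 first.
- by apply/measurable_EFinP; exact: continuous_measurable_borel.
- by rewrite lee_fin invr_ge0 ltW.
have -> : \int[m]_p `|(EFin \o f) p| = \int[m]_p (`|f p|)%:E by [].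
have : 0 <= \int[m]_p (`|f p|)%:E by apply: integral_ge0 => p _; rewrite lee_fin.
case: (\int[m]_p _) => [r _ _||//]; first exact: ltry.
by move=> _; rewrite mulry gtr0_sg ?invr_gt0// mul1e.
Qed.

Lemma integral_cc_linear (m : {measure set B -> \bar R}) :
  locally_finite m -> linear_cc (fun f : T -> R => fine (\int[m]_p (f p)%:E)).
Proof.
move=> mfin a f g cf cg.
have If := cc_integrable mfin cf; have Ig := cc_integrable mfin cg.
have fin h : cc h -> \int[m]_p (h p)%:E \is a fin_num.
  by move=> /(cc_integrable mfin)/integrable_fin_num; exact.
have -> : \int[m]_p (a * f p + g p)%:E =
    a%:E * \int[m]_p (f p)%:E + \int[m]_p (g p)%:E.
  by rewrite -integralZl// -integralD//; exact: integrableZl.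
by rewrite fineD ?fineM ?fin_numM ?fin.
Qed.

Lemma linear_cc_eq (l1 l2 : (T -> R) -> R) : linear_cc l1 -> linear_cc l2 ->
  (forall f, cc f -> (forall p, 0 <= f p <= 1)%R -> l1 f = l2 f) ->
  forall f, cc f -> l1 f = l2 f.
Proof.
move=> l1_lin l2_lin l12 f cf; have [M M0 fM] := cc_bounded cf.
pose fp p := (M^-1 * Num.max (f p) 0)%R; pose fn p := (M^-1 * Num.max (- f p) 0)%R.
have cont0 : continuous (fun _ : T => 0%R : R) by exact: continuous_fct_cst.
have cfp : cc fp.
  apply: ccZ; apply: (cc_sub cf) => [|p ->]; last by rewrite maxxx.
  by apply: continuous_fct_max => //; case: cf.
have cfn : cc fn.
  apply: ccZ; apply: (cc_sub cf) => [|p ->]; last by rewrite oppr0 maxxx.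
  apply: continuous_fct_max => //.
  rewrite (_ : (fun _ => _) = (fun p => 0 - f p)%R); last first.
    by apply/funext => p; rewrite sub0r.
  by apply: continuous_fctB => //; case: cf.
have fp01 p : (0 <= fp p <= 1)%R.
  rewrite /fp mulr_ge0 ?invr_ge0 ?(ltW M0) ?le_max ?lexx ?orbT//=.
  rewrite ler_pdivrMl// mulr1 ge_max (ltW M0) andbT.
  by rewrite (le_trans (ler_norm _)).
have fn01 p : (0 <= fn p <= 1)%R.
  rewrite /fn mulr_ge0 ?invr_ge0 ?(ltW M0) ?le_max ?lexx ?orbT//=.
  rewrite ler_pdivrMl// mulr1 ge_max (ltW M0) andbT.
  by rewrite (le_trans (ler_norm _))// normrN.
have -> : f = (fun p => M * fp p + - M * fn p)%R.
  apply/funext => p; rewrite mulNr !mulVKf ?gt_eqF//.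
  have [f0|f0] := leP (f p) 0%R.
    by rewrite max_l ?oppr_ge0// opprK add0r.
  by rewrite max_r ?subr0// oppr_le0 ltW.
rewrite l1_lin ?l2_lin//; try exact: ccZ.
by rewrite (lin_ccZ l1_lin (- M)%R cfn) (lin_ccZ l2_lin (- M)%R cfn) !l12.
Qed.

Variable V : nat -> set T.
Hypotheses (Vex : exhaustion V) (bumps : @open_bumps R T).

(** With phi the bump of U, the functions min(1, k * phi) lie below the indicator
    of U and above the indicators of the sets phi > 1/k, which increase to U. *)
Lemma measure_open_le (m1 m2 : {measure set B -> \bar R}) (U C : set T) :
  (forall f : T -> R, cc f -> (forall p, 0 <= f p <= 1)%R ->
     \int[m1]_p (f p)%:E = \int[m2]_p (f p)%:E) ->
  open U -> compact C -> U `<=` C -> m1 U <= m2 U.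
Proof.
move=> m12 oU cC UC; have [phi [cphi phi01 phiU]] := bumps oU.
pose W k := [set p | (k.+1%:R^-1 < phi p)%R] : set B.
have mW k : measurable (W k).
  by apply: open_measurable_borel; exact: open_fct_gt.
have UW : U = \bigcup_k W k.
  apply/seteqP; split => [p /phiU phip|p [k _ /= kp]].
    exists (Num.truncn (phi p)^-1) => //.
    by rewrite /W /= invf_plt ?posrE ?ltr0n// truncnS_gt.
  by apply/phiU; rewrite (lt_trans _ kp)// invr_gt0 ltr0n.
have mU : measurable (U : set B) by exact: open_measurable_borel.
have m1W : m1 \o W @ \oo --> m1 U.
  rewrite UW; apply: nondecreasing_cvg_mu => //; first by rewrite -UW.
  move=> i j ij; apply/subsetPset => p /=; apply: le_lt_trans.
  by rewrite lef_pV2 ?posrE ?ltr0n// ler_nat.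
rewrite -(cvg_lim _ m1W)//; apply: lime_le; first by apply/cvg_ex; exists (m1 U).
apply: nearW => k /=.
pose f p := Num.min 1%R (k.+1%:R * phi p)%R.
have cf : cc f.
  split.
    apply: continuous_fct_min; first exact: continuous_fct_cst.
    by apply: continuous_fctM => //; exact: continuous_fct_cst.
  exists C => // p fp; apply: UC; apply/phiU.
  rewrite lt_neqAle (andP (phi01 p)).1 andbT.
  by apply: contra_neq fp; rewrite /f => <-; rewrite mulr0 min_r.
have f01 p : (0 <= f p <= 1)%R.
  by rewrite ge_min lexx/= andbT le_min ler01/= mulr_ge0//; case/andP: (phi01 p).
have mf : measurable_fun setT (EFin \o (f : B -> R)).
  by apply/measurable_EFinP; apply: continuous_measurable_borel; case: cf.
apply: (@le_trans _ _ (\int[m1]_p (f p)%:E)).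
  rewrite -[X in m1 X]setIT -integral_indic//; apply: ge0_le_integral => //.
  - by apply/measurable_EFinP; exact: measurable_indic.
  - move=> p _; rewrite lee_fin indicE; have [|_] := boolP (p \in W k).
      rewrite inE /W /= /f => kp; rewrite le_min lexx/=.
      by rewrite -ler_pdivrMl ?ltr0n// mulr1 ltW.
    by case/andP: (f01 p).
rewrite m12// -[X in m2 X]setIT -integral_indic//; apply: ge0_le_integral => //.
- by move=> p _; rewrite lee_fin; case/andP: (f01 p).
- by apply/measurable_EFinP; exact: measurable_indic.
- move=> p _; rewrite lee_fin indicE; have [|pU] := boolP (p \in U).
    by case/andP: (f01 p).
  have : ~~ (0 < phi p)%R.
    by apply: contra pU => /phiU; exact: mem_set.
  rewrite -leNgt => phi0.
  by rewrite /f (le_trans (_ : _ <= k.+1%:R * phi p)%R) ?ge_min ?lexx ?orbT//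
    mulr_ge0_le0.
Qed.

(** Locally finite Borel measures are determined by their integrals of compactly
    supported functions: these give the measure of the relatively compact open
    sets, which are closed under intersection. *)
Lemma locally_finite_unique (m1 m2 : {measure set B -> \bar R}) :
  locally_finite m1 ->
  (forall f : T -> R, cc f -> (forall p, 0 <= f p <= 1)%R ->
     \int[m1]_p (f p)%:E = \int[m2]_p (f p)%:E) ->
  forall A, measurable A -> m1 A = m2 A.
Proof.
move=> m1fin m12; have [oV Vmono Vcov VC] := Vex.
pose G := [set U : set B | open (U : set T) /\ exists j, U `<=` V j].
apply: (measure_unique G V).
- apply/seteqP; split; last first.
    apply: smallest_sub; first exact: smallest_sigma_algebra.
    by move=> U [oU _]; exact: sub_sigma_algebra.
  apply: smallest_sub; first exact: smallest_sigma_algebra.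
  move=> U oU; have -> : U = \bigcup_j (U `&` V j).
    rewrite -setI_bigcupr; apply/esym/setIidPl => p _.
    by have [j Vj] := Vcov p; exists j.
  apply: sigma_algebra_bigcup => j; apply: sub_sigma_algebra.
  by split; [exact: openI|exists j; exact: subIsetr].
- move=> U W [oU [j Uj]] [oW _]; split; first exact: openI.
  by exists j => p [/Uj].
- by move=> j; split; [exact: oV|exists j].
- by apply/seteqP; split => // p _; have [j Vj] := Vcov p; exists j.
- move=> U [oU [j Uj]]; have [C cC VjC] := VC j.
  have UC := subset_trans Uj VjC.
  apply/eqP; rewrite eq_le (measure_open_le m12 oU cC UC)/=.
  by rewrite (measure_open_le _ oU cC UC)// => f cf f01; rewrite m12.
- by move=> j; have [C cC VjC] := VC j; exact: m1fin cC VjC.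
Qed.

End locally_finite_integral.

Section riesz_cc.
Context {R : realType} {T : ptopologicalType}.
Hypothesis bumps : @open_bumps R T.
Local Notation B := (g_sigma_algebraType (@open T)).

Lemma riesz_representation l l' (l_lin : linear_cc l)
  (l_bnd : locally_bounded_cc l) (l'_lin : linear_cc l')
  (l'_bnd : locally_bounded_cc l') f :
  (forall f, l' f = - l f) -> cc f ->
  l f = fine (\int[riesz_measure bumps l_lin l_bnd]_p (f p)%:E) -
        fine (\int[riesz_measure bumps l'_lin l'_bnd]_p (f p)%:E).
Proof.
move=> ll' cf.
pose J f := fine (\int[riesz_measure bumps l_lin l_bnd]_p (f p)%:E) -
            fine (\int[riesz_measure bumps l'_lin l'_bnd]_p (f p)%:E).
rewrite -[RHS]/(J f); apply: (linear_cc_eq l_lin _ _ cf) => [a g h cg ch|g cg g01].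
  have mP := riesz_locally_finite bumps l_lin l_bnd.
  have mQ := riesz_locally_finite bumps l'_lin l'_bnd.
  rewrite /J (integral_cc_linear mP a cg ch) (integral_cc_linear mQ a cg ch).
  by rewrite mulrBr opprD addrACA.
exact: riesz_cc01.
Qed.

End riesz_cc.

(** * The topology of the upper half space *)

Section upper_half_topology.
Context {R : realType} {n : nat}.
Local Notation H := (upper_half R n).
Local Notation E := ('rV[R]_n * R)%type.
Implicit Types p q : H.

Lemma half_ballE p (e : R) q : ball p e q <-> `|(set_val p : E) - set_val q| < e.
Proof.
rewrite -[ball p e q]/(ball (set_val p : E) e (set_val q)).
by rewrite -ball_normE.
Qed.

Lemma half_nbhsP p (A : set H) : nbhs p A <->
  exists2 r : R, 0 < r & forall q, `|(set_val p : E) - set_val q| < r -> A q.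
Proof.
rewrite nbhs_ballP; split=> [[r r0 rA]|[r r0 rA]]; exists r => // q.
  by move=> /half_ballE/rA.
by move=> /half_ballE/rA.
Qed.

Lemma lipschitz_half_continuous (f : H -> R) :
  (forall p q, f p <= f q + `|(set_val p : E) - set_val q|) -> continuous f.
Proof.
move=> fL p; apply/(@cvgrPdist_lt _ _ _ (nbhs p)) => e e0.
apply/half_nbhsP; exists e => // q pq.
apply: le_lt_trans pq; have := fL p q; have := fL q p.
by rewrite [X in _ + X]distrC ler_norml => ? ?; apply/andP; split; lra.
Qed.

(** The distance to the complement of an open set, truncated at 1, which also
    settles the case of an empty complement. *)
Lemma upper_half_bumps : @open_bumps R H.
Proof.
move=> U oU.
pose D p := [set r : R | r = 1 \/
  exists2 q, ~ U q & r = `|(set_val p : E) - set_val q|].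
have D0 p : lbound (D p) 0 by move=> r [->|[q _ ->]].
have D_lb p : has_lbound (D p) by exists 0.
have D_ne p : D p !=set0 by exists 1; left.
have phi_ge0 p : 0 <= inf (D p) by exact: lb_le_inf.
have phi_le1 p : inf (D p) <= 1 by apply: ge_inf => //; left.
exists (fun p => inf (D p)); split => [|p|p].
- apply: lipschitz_half_continuous => p q; rewrite -lerBlDr.
  apply: lb_le_inf => // r [->|[q' Uq' ->]]; rewrite lerBlDr.
    by rewrite (le_trans (phi_le1 p))// lerDl.
  rewrite addrC (le_trans _ (ler_distD (set_val q) _ _))//.
  by apply: ge_inf => //; right; exists q'.
- by rewrite phi_ge0 phi_le1.
split => [phi0|Up].
  apply: contrapT => nUp; have : inf (D p) <= 0.
    by apply: ge_inf => //; right; exists p => //; rewrite subrr normr0.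
  by rewrite leNgt phi0.
have /half_nbhsP[r r0 rU] : nbhs p U by exact: open_nbhs_nbhs.
apply: (@lt_le_trans _ _ (Num.min 1 r)); first by rewrite lt_min ltr01.
apply: lb_le_inf => // s [->|[q Uq ->]]; first by rewrite ge_min lexx.
by rewrite ge_min; apply/orP; right; rewrite leNgt; apply/negP => /rU.
Qed.

Lemma continuous_set_val : continuous (fun p => set_val p : E).
Proof.
move=> p; apply/(@cvgrPdist_lt _ _ _ (nbhs p)) => e e0.
by apply/half_nbhsP; exists e.
Qed.

Lemma continuous_ball_center : continuous (@Defs.ball_center R n).
Proof.
move=> p; exact: (@cvg_comp _ _ _ (fun p : H => set_val p : E) fst _ _ _
  (@continuous_set_val p) (@cvg_fst _ _ _ _ _)).
Qed.

Lemma continuous_ball_radius : continuous (@ball_radius R n).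
Proof.
move=> p; exact: (@cvg_comp _ _ _ (fun p : H => set_val p : E) snd _ _ _
  (@continuous_set_val p) (@cvg_snd _ _ _ _ _)).
Qed.

Lemma ball_radius_gt0 p : 0 < ball_radius p.
Proof. by rewrite /ball_radius; have /set_mem := svalP p. Qed.

Lemma truncate_subproof (e : R) (e0 : 0 < e) (z : E) :
  ((z.1, Num.max e z.2) : E) \in [set p : E | 0 < p.2].
Proof. by rewrite inE /= lt_max e0. Qed.

(** A retraction of the whole space onto the part t >= e of the half space; it
    transports compactness from the product space. *)
Definition truncate (e : R) (e0 : 0 < e) (z : E) : H :=
  SigSub (truncate_subproof e0 z).

Lemma continuous_truncate (e : R) (e0 : 0 < e) : continuous (truncate e0).
Proof.
move=> z A /half_nbhsP[r r0 rA]; change (nbhs z (truncate e0 @^-1` A)).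
apply/nbhs_ballP; exists r => // w; rewrite -ball_normE /= => zw.
apply: rA; rewrite (le_lt_trans _ zw)// !prod_normE /= ge_max !le_max lexx/=.
apply/orP; right; rewrite ler_norml.
have := ler_norm (z.2 - w.2); have := ler_norm (w.2 - z.2); rewrite distrC.
by move=> h1 h2; case: (leP e z.2); case: (leP e w.2) => ? ?;
  apply/andP; split; lra.
Qed.

Definition half_exhaustion (j : nat) : set H :=
  [set p | [/\ `|Defs.ball_center p| < j.+1%:R, j.+1%:R^-1 < ball_radius p &
               ball_radius p < j.+1%:R]].

Lemma half_exhaustionP : exhaustion half_exhaustion.
Proof.
have cc : continuous (fun p : H => `|Defs.ball_center p|).
  by move=> p; exact: (@cvg_norm _ _ _ (nbhs p) _ _ _ (@continuous_ball_center p)).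
split.
- move=> j; rewrite (_ : half_exhaustion j =
      [set p | `|Defs.ball_center p| < j.+1%:R] `&`
      ([set p | j.+1%:R^-1 < ball_radius p] `&` [set p | ball_radius p < j.+1%:R])).
    apply: openI; first exact: open_fct_lt.
    apply: openI; [apply: open_fct_gt|apply: open_fct_lt];
      exact: continuous_ball_radius.
  by apply/seteqP; split => [p []|p [? []]]; split.
- move=> i j ij p [p1 p2 p3].
  have ij1 : i.+1%:R <= j.+1%:R :> R by rewrite ler_nat.
  split; [exact: lt_le_trans p1 ij1| |exact: lt_le_trans p3 ij1].
  by apply: le_lt_trans p2; rewrite lef_pV2 ?posrE ?ltr0n.
- move=> p; have p0 := ball_radius_gt0 p.
  pose M := `|Defs.ball_center p| + (ball_radius p)^-1 + ball_radius p.
  have Mj := truncnS_gt M; exists (Num.truncn M); set N := _.+1%:R in Mj *.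
  have c0 := normr_ge0 (Defs.ball_center p).
  have r0 : 0 < (ball_radius p)^-1 by rewrite invr_gt0.
  split; rewrite -/N; rewrite /M in Mj; try lra.
  by rewrite invf_plt ?posrE// /N ?ltr0n//; lra.
- move=> j; have j0 : (0 : R) < j.+1%:R^-1 by rewrite invr_gt0 ltr0n.
  pose A : set E := [set x | `|x| <= j.+1%:R] `*` `[j.+1%:R^-1, j.+1%:R].
  exists (truncate j0 @` A).
    apply: continuous_compact; first exact/continuous_subspaceT/continuous_truncate.
    apply: compact_setX; last exact: segment_compact.
    apply: bounded_closed_compact.
      exists j.+1%:R; split => // r jr x /= /le_trans; apply; exact: ltW.
    have : closed ((fun x : 'rV[R]_n => `|x|) @^-1` [set y | y <= j.+1%:R]).
      apply: preimage_closed; last exact: closed_le.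
      by move=> x _; exact: norm_continuous.
    by [].
  move=> p [p1 p2 p3]; exists (set_val p).
    by split; rewrite /= ?in_itv/= ?(ltW p1)// (ltW p2) (ltW p3).
  apply: val_inj => /=; rewrite max_r; last exact: ltW.
  by rewrite -surjective_pairing.
Qed.

End upper_half_topology.

(** * Variations of a signed Radon measure *)

Section relatively_compact.
Context {R : realType} {n : nat}.
Local Notation H := (upper_half R n).
Local Notation B := (borel_half R n).
Implicit Types A E : set H.

Lemma relcompactS A E :
  relcompact_borel A -> measurable (E : set B) -> E `<=` A -> relcompact_borel E.
Proof.
move=> [_ [C cC AsC]] mE EA; split => //; exists C => //; exact: subset_trans AsC.
Qed.

Lemma relcompactU A E :
  relcompact_borel A -> relcompact_borel E -> relcompact_borel (A `|` E).
Proof.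
move=> [mA [C cC AsC]] [mE [D cD ED]]; split; first exact: measurableU.
by exists (C `|` D); [exact: compactU|exact: setUSS].
Qed.

Lemma relcompact0 : relcompact_borel (set0 : set H).
Proof. by split => //; exists set0 => //; exact: compact0. Qed.

Lemma relcompact_exhaustion A : relcompact_borel A ->
  exists j, A `<=` half_exhaustion j.
Proof.
move=> [_ [C cC AsC]]; have [j Cj] := compact_exhaustion half_exhaustionP cC.
by exists j; exact: subset_trans Cj.
Qed.

Lemma half_exhaustion_compact j :
  exists2 C : set H, compact C & half_exhaustion j `<=` C.
Proof. by have [_ _ _] := @half_exhaustionP R n; apply. Qed.

Lemma half_exhaustion_open j : open (half_exhaustion j : set H).
Proof. by have [+ _ _ _] := @half_exhaustionP R n; apply. Qed.

Lemma half_exhaustion_relcompact j : relcompact_borel (half_exhaustion j : set H).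
Proof.
split; last exact: half_exhaustion_compact.
apply: open_measurable_borel; exact: half_exhaustion_open.
Qed.

End relatively_compact.

Section variation_measures.
Context {R : realType} {n : nat}.
Local Notation H := (upper_half R n).
Local Notation B := (borel_half R n).
Implicit Types (mu : set H -> R) (A E : set H).
Local Open Scope ereal_scope.

Lemma signed_radonN mu : signed_radon mu -> signed_radon (fun A => - mu A)%R.
Proof.
move=> mu_radon C cC; have [nu nuE] := mu_radon C cC.
by exists (copp nu) => A mA AsC; rewrite EFinN nuE.
Qed.

Section signed_radon.
Variable mu : set H -> R.
Hypothesis mu_radon : signed_radon mu.

Lemma signed_radon0 : mu set0 = 0%R.
Proof.
have [nu nuE] := mu_radon compact0.
by apply: EFin_inj; rewrite nuE// charge0.
Qed.

Lemma signed_radonU A E : relcompact_borel A -> relcompact_borel E ->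
  A `&` E = set0 -> mu (A `|` E) = (mu A + mu E)%R.
Proof.
move=> [mA [C cC AsC]] [mE [D cD ED]] AE0.
have [nu nuE] := mu_radon (compactU cC cD).
apply: EFin_inj; rewrite EFinD !nuE//.
- exact: chargeU.
- by move=> x /ED; right.
- by move=> x /AsC; left.
- exact: measurableU.
- exact: setUSS.
Qed.

Lemma signed_radonD A E : relcompact_borel A -> measurable (E : set B) ->
  E `<=` A -> mu A = (mu E + mu (A `\` E))%R.
Proof.
move=> rA mE EA; rewrite -signed_radonU ?setDUK ?setDIK//.
- exact: relcompactS EA.
- apply: relcompactS (@subDsetl _ A E) => //.
  by case: rA => mA _; exact: measurableD.
Qed.

Lemma upper_variation_ge A E : relcompact_borel A -> A `<=` E ->
  (mu A)%:E <= upper_variation mu E.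
Proof. by move=> rA AE; apply: ereal_sup_ubound; exists A. Qed.

Lemma upper_variation_ge0 E : 0 <= upper_variation mu E.
Proof.
have := @upper_variation_ge _ E relcompact0 (sub0set E).
by rewrite signed_radon0.
Qed.

Lemma upper_variation0 : upper_variation mu set0 = 0.
Proof.
apply/eqP; rewrite eq_le upper_variation_ge0 andbT.
apply: ge_ereal_sup => _ [A [_ A0] <-]; rewrite lee_fin.
by rewrite (_ : A = set0) ?signed_radon0//; apply/seteqP; split.
Qed.

Lemma le_upper_variation A E : A `<=` E ->
  upper_variation mu A <= upper_variation mu E.
Proof.
move=> AE; apply: ereal_sup_le => _ [D [rD DA] <-]; exists D => //.
by split => //; exact: subset_trans AE.
Qed.

Lemma upper_variationU A E : A `&` E = set0 ->
  upper_variation mu A + upper_variation mu E <= upper_variation mu (A `|` E).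
Proof.
move=> AE0; set M := upper_variation mu (A `|` E).
have EM : upper_variation mu E <= M by apply: le_upper_variation; right.
have [Mfin|] := boolP (M \is a fin_num); last first.
  by rewrite ge0_fin_numE ?upper_variation_ge0// -leNgt leye_eq => /eqP ->; rewrite leey.
have Efin : upper_variation mu E \is a fin_num.
  rewrite ge0_fin_numE ?upper_variation_ge0//; apply: le_lt_trans EM _.
  by rewrite ltey_eq Mfin.
rewrite -leeBrDr//; apply: ge_ereal_sup => _ [A' [rA' A'A] <-].
rewrite leeBrDr// addeC -leeBrDr//; apply: ge_ereal_sup => _ [E' [rE' E'E] <-].
rewrite leeBrDr// addeC -EFinD -signed_radonU//.
  by apply: upper_variation_ge; [exact: relcompactU|exact: setUSS].
apply/seteqP; split => // x [/A'A Ax /E'E Ex].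
by rewrite -AE0.
Qed.

(** A set competing for the union is relatively compact, so that mu is countably
    additive on its Borel subsets; the converse inequality follows from the
    superadditivity on finite disjoint unions. *)
Lemma upper_variation_bigcup (F : nat -> set B) :
  (forall k, measurable (F k)) -> trivIset setT F ->
  upper_variation mu (\bigcup_k F k) = \sum_(k <oo) upper_variation mu (F k).
Proof.
move=> mF tF; apply/eqP; rewrite eq_le; apply/andP; split; last first.
  apply: lime_le.
    by apply: is_cvg_nneseries => k _ _; exact: upper_variation_ge0.
  apply: nearW => N.
  apply: (@le_trans _ _ (upper_variation mu (\bigcup_(k < N) F k))).
    elim: N => [|N IH]; first by rewrite big_geq// upper_variation_ge0.
    rewrite big_nat_recr//=; apply: le_trans (leeD IH (lexx _)) _.
    apply: (@le_trans _ _ (upper_variation mu (\bigcup_(k < N) F k `|` F N))).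
      apply: upper_variationU; apply/seteqP; split => // x [[k /= kN Fk] FN].
      have kN' : k = N by apply: tF => //; exists x.
      by rewrite kN' ltnn in kN.
    apply: le_upper_variation => x [[k /= kN Fk]|FN]; last by exists N => /=.
    by exists k => //=; exact: ltnW.
  by apply: le_upper_variation; apply: bigcup_sub => k _; exact: bigcup_sup.
apply: ge_ereal_sup => _ [A [rA AF] <-].
have [mA [C cC AsC]] := rA; have [nu nuE] := mu_radon cC.
have mAF k : measurable (A `&` F k : set B) by exact: measurableI.
have AFE : A = \bigcup_k (A `&` F k).
  by rewrite -setI_bigcupr; apply/esym/setIidPl.
have := @charge_semi_sigma_additive _ _ _ nu (fun k => A `&` F k) mAF.
have tAF : trivIset setT (fun k => A `&` F k).
  by apply: trivIset_setIl.
rewrite -AFE => /(_ tAF mA) nuA.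
rewrite nuE// -(cvg_lim _ nuA)//.
apply: lee_lim; first by apply/cvg_ex; exists (nu A).
  by apply: is_cvg_nneseries => k _ _; exact: upper_variation_ge0.
apply: nearW => N; apply: lee_sum => k _.
rewrite -nuE//; last by move=> x [/AsC].
apply: upper_variation_ge; last by move=> x [].
by apply: relcompactS rA _ _ => // x [].
Qed.

(** The hypothesis is an argument, so that the structure of a measure can be
    attached to the upper variation. *)
Definition positive_variation (mu : set H -> R) of signed_radon mu :
  set B -> \bar R := upper_variation mu.

Let sigma_add : semi_sigma_additive (positive_variation mu_radon).
Proof.
move=> F mF tF _; rewrite /positive_variation upper_variation_bigcup//.
by apply: is_cvg_nneseries => k _ _; exact: upper_variation_ge0.
Qed.

HB.instance Definition _ := isMeasure.Build _ _ _ (positive_variation mu_radon)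
  upper_variation0 upper_variation_ge0 sigma_add.

(** On a compact set mu is a charge, and the positive part of its Hahn
    decomposition bounds the upper variation. *)
Lemma upper_variation_lty A : relcompact_borel A -> upper_variation mu A < +oo.
Proof.
move=> [mA [C cC AsC]]; have [nu nuE] := mu_radon cC.
have [P [N PN]] := Hahn_decomposition nu.
apply: (@le_lt_trans _ _ (jordan_pos PN setT)); last first.
  by rewrite ltey_eq fin_num_measure.
apply: ge_ereal_sup => _ [D [[mD _] DA] <-].
rewrite nuE//; last exact: subset_trans AsC.
rewrite (jordan_decomp PN mD) /cadd /= /cscale.
rewrite (@le_trans _ _ (jordan_pos PN D))//.
  rewrite -[leRHS]adde0; apply: leeD => //.
  by rewrite mulN1e oppe_le0 measure_ge0.
by apply: le_measure; rewrite ?inE.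
Qed.

End signed_radon.

(** Replacing a subset D of A by its complement in A exchanges mu D with
    mu A - mu D. *)
Lemma jordan_signed_radon mu A : signed_radon mu -> relcompact_borel A ->
  upper_variation mu A = (mu A)%:E + lower_variation mu A.
Proof.
move=> mu_radon rA; have muN := signed_radonN mu_radon.
have rS D : measurable (D : set B) -> D `<=` A ->
    relcompact_borel D /\ relcompact_borel (A `\` D).
  move=> mD DA; split; first exact: relcompactS DA.
  by apply: relcompactS (@subDsetl _ A D) => //; case: rA => mA _; exact: measurableD.
have lower_fin : lower_variation mu A \is a fin_num.
  by rewrite ge0_fin_numE ?upper_variation_ge0//; exact: upper_variation_lty.
apply/eqP; rewrite eq_le; apply/andP; split.
  apply: ge_ereal_sup => _ [D [[mD _] DA] <-]; have [rD rAD] := rS _ mD DA.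
  rewrite -leeBlDl// -EFinB (signed_radonD mu_radon rA mD DA) opprD addNKr.
  apply: upper_variation_ge => //; exact: subDsetl.
rewrite -leeBrDl//; apply: ge_ereal_sup => _ [D [[mD _] DA] <-].
have [rD rAD] := rS _ mD DA.
rewrite leeBrDl// -EFinD (signed_radonD mu_radon rA mD DA) addrAC subrr add0r.
by apply: upper_variation_ge => //; exact: subDsetl.
Qed.

End variation_measures.

(** * Signed integrals *)

Section signed_radon_theory.
Context {R : realType} {n : nat}.
Local Notation H := (upper_half R n).
Local Notation B := (borel_half R n).
Implicit Types (mu : set H -> R) (A E : set H) (P Q : {measure set B -> \bar R}).
Local Open Scope ereal_scope.

Lemma relcompact_lty P A : locally_finite P -> relcompact_borel A -> P A < +oo.
Proof.
move=> Pfin rA; have [j Aj] := relcompact_exhaustion rA.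
have [C cC jC] := @half_exhaustion_compact R n j.
apply: le_lt_trans (Pfin _ _ (@half_exhaustion_open R n j) cC jC).
apply: le_measure; rewrite ?inE//; first by case: rA.
by case: (@half_exhaustion_relcompact R n j).
Qed.

Lemma relcompact_measure_unique P Q : locally_finite P ->
  (forall A, relcompact_borel A -> P A = Q A) ->
  forall A : set B, measurable A -> P A = Q A.
Proof.
move=> Pfin PQ.
apply: (measure_unique (relcompact_borel : set (set B)) half_exhaustion).
- apply/seteqP; split; last first.
    by apply: smallest_sub => [|A [mA _]]; [exact: sigma_algebra_measurable|].
  apply: smallest_sub; first exact: smallest_sigma_algebra.
  move=> U oU; have -> : U = \bigcup_j (U `&` half_exhaustion j).
    rewrite -setI_bigcupr; apply/esym/setIidPl => p _.
    have [_ _ /(_ p)[j pj] _] := @half_exhaustionP R n.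
    by exists j.
  apply: sigma_algebra_bigcup => j; apply: sub_sigma_algebra.
  apply: relcompactS (@half_exhaustion_relcompact R n j) _ _.
    apply: open_measurable_borel; apply: openI => //.
    exact: half_exhaustion_open.
  exact: subIsetr.
- move=> A E rA [mE _]; apply: (relcompactS rA); last exact: subIsetl.
  by apply: measurableI => //; case: rA.
- exact: half_exhaustion_relcompact.
- apply/seteqP; split => // p _.
  by have [_ _ /(_ p)[j pj] _] := @half_exhaustionP R n; exists j.
- exact: PQ.
- by move=> j; apply: relcompact_lty => //; exact: half_exhaustion_relcompact.
Qed.

Lemma variation_locally_finite mu (h : signed_radon mu) :
  locally_finite (positive_variation h).
Proof.
move=> U C oU cC UC; apply: (upper_variation_lty h).
by split; [exact: open_measurable_borel|exists C].
Qed.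

Lemma locally_finiteD P Q : locally_finite P -> locally_finite Q ->
  locally_finite (measure_add P Q).
Proof.
move=> Pfin Qfin U C oU cC UC.
by rewrite measure_addE lte_add_pinfty//; [exact: Pfin UC|exact: Qfin UC].
Qed.

(** The two differences need not make sense on large sets; moving the negative
    parts to the other side gives an equality of sums of measures, valid on all
    Borel sets. *)
Lemma signed_integral_cc mu P Q : signed_radon mu ->
  locally_finite P -> locally_finite Q ->
  (forall A, relcompact_borel A -> (mu A)%:E + Q A = P A) ->
  forall f : H -> R, cc f -> signed_integral mu f =
    (fine (\int[P]_p (f p)%:E) - fine (\int[Q]_p (f p)%:E))%R.
Proof.
move=> h Pfin Qfin muPQ f cf; pose h' := signed_radonN h.
have hfin := variation_locally_finite h.
have h'fin := variation_locally_finite h'.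
have : \int[measure_add (positive_variation h) Q]_p (f p)%:E =
       \int[measure_add (positive_variation h') P]_p (f p)%:E.
  apply: eq_measure_integral => A mA _; move: A mA.
  apply: relcompact_measure_unique; first exact: locally_finiteD.
  move=> A rA; transitivity (upper_variation mu A + Q A).
    exact: measure_addE.
  transitivity (lower_variation mu A + P A); last exact/esym/measure_addE.
  by rewrite (jordan_signed_radon h rA) -(muPQ _ rA) addeAC addeC.
rewrite !integral_measure_add//; try exact: cc_integrable.
have fin P' : locally_finite P' -> \int[P']_p (f p)%:E \is a fin_num.
  by move=> P'fin; exact: integrable_fin_num (cc_integrable P'fin cf).
rewrite -(fineK (fin _ hfin)) -(fineK (fin _ Qfin)) -(fineK (fin _ Pfin)).
rewrite -(fineK (fin _ h'fin)) -!EFinD => -[].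
rewrite /signed_integral -[lower_variation mu]/(positive_variation h' : set B -> _).
rewrite -[upper_variation mu]/(positive_variation h : set B -> _).
lra.
Qed.

Definition measure_diff P Q A : R := (fine (P A) - fine (Q A))%R.

Lemma measure_diffE P Q A : locally_finite P -> locally_finite Q ->
  relcompact_borel A -> (measure_diff P Q A)%:E + Q A = P A.
Proof.
move=> Pfin Qfin rA.
have PA : P A \is a fin_num by rewrite ge0_fin_numE//; exact: relcompact_lty.
have QA : Q A \is a fin_num by rewrite ge0_fin_numE//; exact: relcompact_lty.
by rewrite /measure_diff EFinB !fineK// subeK.
Qed.

Lemma measure_diff_le P Q A : locally_finite P -> locally_finite Q ->
  relcompact_borel A -> (measure_diff P Q A)%:E <= P A.
Proof. by move=> Pfin Qfin rA; rewrite -(measure_diffE Pfin Qfin rA) leeDl. Qed.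

Lemma measure_diff_signed_radon P Q : locally_finite P -> locally_finite Q ->
  signed_radon (measure_diff P Q).
Proof.
move=> Pfin Qfin C cC; have [j Cj] := compact_exhaustion half_exhaustionP cC.
have [mV _] := @half_exhaustion_relcompact R n j.
have rV := @half_exhaustion_relcompact R n j.
pose nuP := charge_of_finite_measure (mfrestr mV (relcompact_lty Pfin rV)).
pose nuQ := charge_of_finite_measure (mfrestr mV (relcompact_lty Qfin rV)).
exists (cadd nuP (copp nuQ)) => A mA AsC.
have rA : relcompact_borel A by split => //; exists C.
have AV : A `&` half_exhaustion j = A by apply/setIidPl; exact: subset_trans Cj.
transitivity (P (A `&` half_exhaustion j) - Q (A `&` half_exhaustion j)).
  rewrite AV /measure_diff EFinB !fineK//.
  - by rewrite ge0_fin_numE//; exact: relcompact_lty.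
  - by rewrite ge0_fin_numE//; exact: relcompact_lty.
by [].
Qed.

(** Again the negative parts change sides, and locally finite measures are
    determined by their integrals of compactly supported functions. *)
Lemma signed_radon_unique mu mu' : signed_radon mu -> signed_radon mu' ->
  (forall f : H -> R, cc f -> signed_integral mu f = signed_integral mu' f) ->
  forall A, relcompact_borel A -> mu A = mu' A.
Proof.
move=> h k muf A rA; pose h' := signed_radonN h; pose k' := signed_radonN k.
have hfin := variation_locally_finite h.
have h'fin := variation_locally_finite h'.
have kfin := variation_locally_finite k.
have k'fin := variation_locally_finite k'.
have : measure_add (positive_variation h) (positive_variation k') A =
    measure_add (positive_variation k) (positive_variation h') A.
  apply: (locally_finite_unique half_exhaustionP upper_half_bumps).
  - exact: locally_finiteD.
  - move=> f cf f01.
    have fin P' : locally_finite P' -> \int[P']_p (f p)%:E \is a fin_num.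
      by move=> P'fin; exact: integrable_fin_num (cc_integrable P'fin cf).
    rewrite !integral_measure_add//; try exact: cc_integrable.
    rewrite -(fineK (fin _ hfin)) -(fineK (fin _ h'fin)) -(fineK (fin _ kfin)).
    rewrite -(fineK (fin _ k'fin)) -!EFinD; congr (_%:E).
    have : (fine (\int[positive_variation h]_p (f p)%:E) -
            fine (\int[positive_variation h']_p (f p)%:E) =
            fine (\int[positive_variation k]_p (f p)%:E) -
            fine (\int[positive_variation k']_p (f p)%:E))%R by exact: muf.
    by move=> ?; lra.
  - by case: rA.
rewrite !measure_addE => e.
have {e} : upper_variation mu A + lower_variation mu' A =
    upper_variation mu' A + lower_variation mu A by exact: e.
rewrite (jordan_signed_radon h rA) (jordan_signed_radon k rA).
have lfin nu : signed_radon nu -> lower_variation nu A \is a fin_num.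
  move=> /signed_radonN nuN; rewrite ge0_fin_numE ?upper_variation_ge0//.
  exact: upper_variation_lty.
by rewrite -(fineK (lfin _ h)) -(fineK (lfin _ k)) -!EFinD => -[]; lra.
Qed.

End signed_radon_theory.

(** * A weighted sum bounded by a sum over an independent set *)

Section fractional_colouring.
Context {R : realType} {I : finType}.
Variables (r w : I -> R) (adj : rel I) (L : R).
Hypotheses (w_ge0 : forall i, 0 <= w i) (adj_refl : reflexive adj)
  (adj_sym : symmetric adj)
  (adj_le : forall i, \sum_(j | (r i <= r j) && adj i j) w j <= L).

(** The local ratio argument: let i have the least r among the indices where
    f is positive, and lower f by f i on the neighbours of i. The weighted sum
    drops by at most L * f i, and an independent set that is good for the
    lowered function gains f i, after i is added to it if it contains no
    neighbour of i. *)
Lemma weighted_sum_le_independent (f : I -> R) : (forall i, 0 <= f i) ->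
  exists S : pred I,
    [/\ forall i j, S i -> S j -> adj i j -> i = j, forall i, S i -> 0 < f i &
        \sum_i w i * f i <= L * \sum_(i | S i) f i].
Proof.
have [m] := ubnP #|[pred i | 0 < f i]|; elim: m f => // m IH f fm f0.
have [i0 fi0|fall] := pickP [pred i | 0 < f i]; last first.
  exists pred0; split => //; rewrite big_pred0_eq mulr0 big1// => i _.
  have := fall i; rewrite /= lt_neqAle f0 andbT => /negbFE/eqP <-.
  by rewrite mulr0.
have [i fi imin] := @Order.TotalTheory.arg_minP _ _ _ i0 [pred i | 0 < f i] r fi0.
rewrite /= in fi imin.
pose f' j := if adj i j then Num.max (f j - f i) 0 else f j.
have f'0 j : 0 <= f' j by rewrite /f'; case: ifP => // _; rewrite le_max lexx orbT.
have f'le j : f' j <= f j.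
  by rewrite /f'; case: ifP => // _; rewrite ge_max f0 andbT gerBl ltW.
have f'i : f' i = 0 by rewrite /f' adj_refl subrr maxxx.
have [|S [Sind Spos Sle]] := IH f' _ f'0.
  rewrite -ltnS (leq_trans _ fm)// ltnS; apply: proper_card.
  apply/properP; split; last by exists i; rewrite !inE ?f'i ?ltxx.
  by apply/fintype.subsetP => j; rewrite !inE => /lt_le_trans; apply.
have L0 : 0 <= L.
  by apply: le_trans (adj_le i); apply: sumr_ge0 => j _; exact: w_ge0.
have wf : \sum_j w j * f j <= \sum_j w j * f' j + L * f i.
  apply: (@le_trans _ _ (\sum_j w j * f' j +
      \sum_(j | (r i <= r j) && adj i j) w j * f i)); last first.
    by rewrite lerD2l -mulr_suml ler_wpM2r// ltW.
  rewrite [X in _ + X]big_mkcond/= -big_split/=; apply: ler_sum => j _.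
  have [fj|fj] := ltP 0 (f j).
    rewrite (imin j fj)/= /f'; case: ifP => _; last by rewrite addr0.
    by rewrite -mulrDr ler_wpM2l// -lerBlDr le_max lexx.
  have -> : f j = 0 by apply/eqP; rewrite eq_le fj f0.
  rewrite mulr0 addr_ge0// ?mulr_ge0//.
  by case: ifP => // _; rewrite mulr_ge0// ltW.
have f'E j : S j -> f j = f' j + (if adj i j then f i else 0).
  move=> /Spos; rewrite /f'; case: ifP => _; last by rewrite addr0.
  by rewrite lt_max ltxx orbF subr_gt0 => fij; rewrite max_l ?subrK// subr_ge0 ltW.
have [[j Sj ij]|noadj] := pselect (exists2 j, S j & adj i j).
  exists S; split => // [k /Spos/lt_le_trans->//|].
  apply: le_trans wf _; apply: le_trans (lerD Sle (lexx _)) _.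
  rewrite -mulrDr ler_wpM2l// [in leRHS](bigD1 j)//= (f'E j Sj) ij.
  rewrite [in leLHS](bigD1 j)//= addrAC lerD2l.
  by apply: ler_sum.
have iS : ~~ S i by apply/negP => /Spos; rewrite f'i ltxx.
exists (predU1 i S); split.
- move=> j k /predU1P[->|Sj] /predU1P[->|Sk]// jk; last exact: Sind.
    by case: noadj; exists k.
  by case: noadj; exists j => //; rewrite adj_sym.
- by move=> j /predU1P[->//|/Spos/lt_le_trans]; apply.
apply: le_trans wf _; apply: le_trans (lerD Sle (lexx _)) _.
rewrite -mulrDr ler_wpM2l// [leRHS](bigD1 i)/= ?eqxx// [leLHS]addrC lerD2l.
rewrite [leRHS](eq_bigl S); last first.
  by move=> j /=; case: eqVneq => [->|]; rewrite ?(negbTE iS)//= andbT.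
by apply: ler_sum.
Qed.

End fractional_colouring.

(** * The Carleson embedding *)

Lemma measure_finite_cover d (T : measurableType d) (R : realType)
    (m : {measure set T -> \bar R}) (Z : finType) (G : Z -> set T) (A : set T) :
  measurable A -> (forall z, measurable (G z)) -> A `<=` \bigcup_z G z ->
  (m A <= \sum_z m (G z))%E.
Proof.
move=> mA mG AG.
suff h (s : seq Z) E : measurable E ->
    (forall x, E x -> exists2 z, z \in s & G z x) -> (m E <= \sum_(z <- s) m (G z))%E.
  apply: h => // x /AG[z _ Gz]; exists z => //; exact: mem_index_enum.
elim: s E => [|z s IH] E mE Es.
  rewrite (_ : E = set0) ?measure0 ?big_nil//.
  by apply/seteqP; split => // x /Es[].
rewrite big_cons (measureDI m mE (mG z)) addeC; apply: leeD.
  by apply: le_measure; rewrite ?inE//; exact: measurableI.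
apply: IH => [|x [/Es[z' + Gz'] nGz]]; first exact: measurableD.
by rewrite inE => /predU1P[z'z|zs]; [rewrite -z'z in nGz|exists z'].
Qed.

Definition cone_cover_card (n : nat) := #|{ffun 'I_n -> 'I_(24 * n).+1}|.

Section carleson_embedding.
Context {R : realType} {n : nat} (K : set 'rV[R]_n).
Hypothesis Kbody : symmetric_convex_body K.
Local Notation N := (body_norm K).
Local Notation H := (upper_half R n).
Local Notation B := (borel_half R n).
Implicit Types p q : H.

(** The balls that contain x in their interior. *)
Definition open_cone (x : 'rV[R]_n) : set H :=
  [set p | N (x - Defs.ball_center p) < ball_radius p].

Lemma continuous_center_dist x : continuous (fun p : H => N (x - Defs.ball_center p)).
Proof.
move=> p; apply: (@continuous_comp _ _ _ (fun p : H => x - Defs.ball_center p) N p).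
  exact: (@cvgB _ _ _ (nbhs p) _ (fun=> x) (@Defs.ball_center R n) _ _
    (cvg_cst x) (@continuous_ball_center R n p)).
exact: continuous_body_norm.
Qed.

Lemma open_open_cone x : open (open_cone x).
Proof.
have := @open_fct_gt R H _ 0 (continuous_fctB (@continuous_ball_radius R n)
  (@continuous_center_dist x)).
by congr open; apply/seteqP; split => p /=; rewrite subr_gt0.
Qed.

Lemma measurable_cone x : measurable (cone K x : set B).
Proof.
rewrite -[cone K x]setCK; apply: measurableC; apply: open_measurable_borel.
have := @open_fct_lt R H _ 0 (continuous_fctB (@continuous_ball_radius R n)
  (@continuous_center_dist x)).
congr open; apply/seteqP; split => p /=.
  by rewrite subr_lt0 => + /le_lt_trans h => /h; rewrite ltxx.
by move=> /negP; rewrite -ltNge subr_lt0.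
Qed.

Lemma ball_meets p q : ball_of K p `&` ball_of K q !=set0 ->
  N (Defs.ball_center p - Defs.ball_center q) <= ball_radius p + ball_radius q.
Proof.
move=> [y [yp yq]]; rewrite (le_trans (body_norm_tri Kbody _ y _))// lerD//.
by rewrite body_norm_sub.
Qed.

(** The hypothesis on S says that the balls p i, for i in S, are pairwise
    disjoint: balls that meet satisfy the inequality. *)
Lemma S1_norm_ge_family (f : H -> R) m (p : 'I_m -> H) (S : pred 'I_m) :
  (forall i j, S i -> S j ->
     N (Defs.ball_center (p i) - Defs.ball_center (p j)) <=
       ball_radius (p i) + ball_radius (p j) -> i = j) ->
  ((\sum_(i | S i) `|f (p i)|)%:E <= S1_norm K f)%E.
Proof.
move=> Sind; pose s := [seq p i | i <- enum S].
have us : uniq s.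
  rewrite map_inj_in_uniq ?enum_uniq// => i j; rewrite !mem_enum => Si Sj pij.
  apply: Sind => //; rewrite pij subrr body_norm0// addr_ge0//;
    exact/ltW/ball_radius_gt0.
have -> : \sum_(i | S i) `|f (p i)| = \sum_(q <- s) `|f q|.
  by rewrite big_map big_enum.
rewrite -sumEFin fsbig_seq//; apply: ereal_sup_ubound; exists [set` s] => //.
split; first exact: finite_seq.
move=> q q' /= /mapP[i + ->] /mapP[j + ->]; rewrite !mem_enum => Si Sj.
by move=> /ball_meets/(Sind _ _ Si Sj) ->.
Qed.

Variables (nu : {measure set B -> \bar R}) (D : set 'rV[R]_n) (M : R).
Hypotheses (nu_fin : locally_finite nu) (dD : dense D).
Hypothesis nuM : forall z, D z -> (nu (cone K z) <= M%:E)%E.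

(** The bound on the cones is only available for vertices in D; the covering
    lemma provides such cones. *)
Lemma carleson_box (A : set B) (x : 'rV[R]_n) (t : R) : measurable A -> 0 < t ->
  (forall q, A q -> t <= ball_radius q /\
     N (x - Defs.ball_center q) <= ball_radius q + 3 / 2 * t) ->
  (nu A <= ((cone_cover_card n)%:R * M)%:E)%E.
Proof.
move=> mA t0 At; have [z [zD zP]] := cone_cover Kbody x dD t0.
apply: (@le_trans _ _ (\sum_k nu (cone K (z k)))%E).
  apply: measure_finite_cover => // [k|q /At[tq /(zP _ _ tq)[k /ltW kq]]].
    exact: measurable_cone.
  by exists k.
apply: (@le_trans _ _ (\sum_(k : {ffun 'I_n -> 'I_(24 * n).+1}) M%:E)%E).
  by apply: lee_sum => k _; exact: nuM.
by rewrite sumEFin lee_fin sumr_const -[leLHS]mulr_natl.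
Qed.

Variables (f : H -> R) (s : R).
Hypotheses (cf : continuous f) (fs : (S1_norm K f <= s%:E)%E).

(** Cut V into small sets Q k, of measure w k, on which |f| exceeds its value at
    a point p_ k by at most eta. Call two indices adjacent when the balls of p_
    satisfy the inequality that holds for intersecting balls. The sets Q k of the
    larger neighbours of p_ i lie in a box above p_ i, which bounds their total
    measure, and so the sum of the w k * |f (p_ k)| is controlled by a sum of |f|
    over a family of disjoint balls. *)
Lemma carleson_compact (C : set H) (V : set H) : compact C -> open V -> V `<=` C ->
  (\int[nu]_(p in V) (`|f p|)%:E <= ((cone_cover_card n)%:R * M * s)%:E)%E.
Proof.
move=> cC oV VC; set L := (cone_cover_card n)%:R * M.
have [tau tau0 Ctau] := compact_pos_lb (@continuous_ball_radius R n) cC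
  (fun p _ => ball_radius_gt0 p).
have nuVfin : nu V \is a fin_num.
  by rewrite ge0_fin_numE//; exact: nu_fin cC VC.
apply/lee_addgt0Pr => eta0 eta0_gt0.
pose eta := eta0 / (fine (nu V) + 1).
have nuV0 : 0 <= fine (nu V) by exact: fine_ge0.
have eta_gt0 : 0 < eta by rewrite divr_gt0// ltr_wpDl.
(* Replacing p_ k by a point of U (p_ k) moves the center by less than d and
   lowers the radius by less than d. Below, d is at most a tenth of the radius of
   p_ i, and the constants satisfy 1 + 2/10 <= 3/2 * (9/10). *)
pose d := tau / 10; have d0 : 0 < d by rewrite divr_gt0.
pose U p := [set q | `|f q| < `|f p| + eta] `&`
  ([set q | N (Defs.ball_center p - Defs.ball_center q) < d] `&`
   ([set q | ball_radius q < ball_radius p + d] `&`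
    [set q | ball_radius p - d < ball_radius q])).
have oU p : open (U p).
  apply: openI.
    by apply: open_fct_lt; exact: continuous_fct_norm.
  apply: openI; first by apply: open_fct_lt; exact: continuous_center_dist.
  by apply: openI; [apply: open_fct_lt|apply: open_fct_gt];
    exact: continuous_ball_radius.
have Upp p : U p p.
  split; first by rewrite /= ltrDl.
  split; first by rewrite /= subrr body_norm0.
  by split; rewrite /= ?ltrDl// ltrBlDr ltrDl.
have [D' D'C CD'] : finite_subset_cover C U C.
  move: cC; rewrite compact_cover; apply => [p _|p Cp]; first exact: oU.
  by exists p.
pose sp := enum_fset D'; pose m := size sp; pose p_ k := nth point sp k.
have p_C k : (k < m)%N -> C (p_ k) by move=> km; apply/set_mem/D'C/mem_nth.
pose F k : set B := V `&` U (p_ k).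
have mF k : measurable (F k).
  by apply: open_measurable_borel; apply: openI => //; exact: oU.
pose Q := seqDU F.
have mQ k : measurable (Q k).
  by apply: measurableD => //; exact: bigsetU_measurable.
have QF k : Q k `<=` F k by exact: subset_seqDU.
have tQ : trivIset setT Q by exact: trivIset_seqDU.
have VQ q : V q -> exists2 k, (k < m)%N & Q k q.
  move=> Vq; have [p pD' Uq] := CD' _ (VC _ Vq).
  have : (\big[setU/set0]_(k < m) F k) q.
    rewrite -bigcup_mkord; exists (index p sp); first by rewrite /= index_mem.
    by split => //; rewrite /p_ nth_index.
  by rewrite bigsetU_seqDU -bigcup_mkord => -[k km Qk]; exists k.
have Qfin k : nu (Q k) \is a fin_num.
  rewrite ge0_fin_numE//; apply: (@le_lt_trans _ _ (nu V)); last by rewrite ltey_eq nuVfin.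
  apply: le_measure; rewrite ?inE//; first exact: open_measurable_borel.
  by move=> q /QF[].
pose w k := fine (nu (Q k)).
have w0 k : 0 <= w k by exact: fine_ge0.
have sumw : \sum_(k < m) w k <= fine (nu V).
  rewrite -lee_fin -sumEFin fineK//; under eq_bigr do rewrite fineK//.
  rewrite -(measure_bigsetU nu mQ tQ); apply: le_measure; rewrite ?inE.
  - exact: bigsetU_measurable.
  - exact: open_measurable_borel.
  - by rewrite -bigcup_mkord => q [k _ /QF[]].
have mV : measurable (V : set B) by exact: open_measurable_borel.
have cnf := continuous_fct_norm cf.
pose c k : R := `|f (p_ k)| + eta.
have c0 k : 0 <= c k by rewrite addr_ge0// ltW.
have mi k : measurable_fun (V : set B) (fun q => (\1_(Q k) q : R)%:E).
  by apply/measurable_EFinP; exact: measurable_indic.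
have mc k : measurable_fun (V : set B) (fun q => (c k)%:E * (\1_(Q k) q)%:E)%E.
  exact: measurable_funeM.
have step1 : (\int[nu]_(p in V) (`|f p|)%:E <=
    (\sum_(k < m) w k * `|f (p_ k)| + \sum_(k < m) w k * eta)%:E)%E.
  apply: (@le_trans _ _
      (\int[nu]_(q in V) \sum_(k < m) ((c k)%:E * (\1_(Q k) q)%:E))%E).
    apply: ge0_le_integral => //.
    - apply: measurable_funTS; apply/measurable_EFinP.
      exact: continuous_measurable_borel.
    - by apply: emeasurable_sum.
    - move=> q /VQ[k km Qk]; rewrite (bigD1 (Ordinal km))//= indicE mem_set// mule1.
      apply: (@le_trans _ _ (c k)%:E).
        by rewrite lee_fin ltW//; case: (QF k q Qk) => _ [].
      rewrite leeDl//; apply: sume_ge0 => j _.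
      by rewrite mule_ge0// lee_fin.
  rewrite ge0_integral_sum//; last by move=> k q _; rewrite mule_ge0// lee_fin.
  rewrite -big_split/= -sumEFin; apply: lee_sum => k _.
  rewrite (ge0_integralZl nu mV (mi k))// ?lee_fin//.
  rewrite integral_indic// (_ : Q k `&` V = Q k); last first.
    by apply/setIidPl => q /QF[].
  by rewrite -(fineK (Qfin k)) -EFinM lee_fin -mulrDr mulrC.
apply: le_trans step1 _; rewrite -EFinD lee_fin; apply: lerD; last first.
  rewrite -mulr_suml /eta mulrA ler_pdivrMr ?ltr_wpDl// mulrC ler_pM2l//.
  by rewrite (le_trans sumw)// lerDl.
pose adj (i j : 'I_m) := N (Defs.ball_center (p_ i) - Defs.ball_center (p_ j)) <=
  ball_radius (p_ i) + ball_radius (p_ j).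
have [||i|S [Sind _ Sle]] := @weighted_sum_le_independent R 'I_m
    (fun i => ball_radius (p_ i)) (fun i => w i) adj L (fun i => w0 i) _ _ _
    (fun i => `|f (p_ i)|) (fun i => normr_ge0 _).
- move=> i; rewrite /adj subrr body_norm0//.
  by rewrite addr_ge0// ltW// ball_radius_gt0.
- by move=> i j; rewrite /adj body_norm_sub// [ball_radius _ + _]addrC.
- (* The sets Q k of the larger neighbours of p_ i lie in one Carleson box. *)
  pose J k := (ball_radius (p_ i) <= ball_radius (p_ k)) &&
    (N (Defs.ball_center (p_ i) - Defs.ball_center (p_ k)) <=
       ball_radius (p_ i) + ball_radius (p_ k)).
  pose A k := if J k then Q k else set0.
  have mA k : measurable (A k) by rewrite /A; case: ifP.
  have tA : trivIset setT A.
    apply/trivIsetP => j k _ _ jk; rewrite /A; case: ifP => _; rewrite ?set0I//.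
    by case: ifP => _; rewrite ?setI0//; by move/trivIsetP : tQ; apply.
  have -> : \sum_(j < m | (ball_radius (p_ i) <= ball_radius (p_ j)) && adj i j) w j
      = \sum_(j < m) fine (nu (A j)).
    rewrite big_mkcond/=; apply: eq_bigr => j _; rewrite /A /J /adj.
    by case: ifP => // _; rewrite measure0.
  have Afin k : nu (A k) \is a fin_num.
    by rewrite /A; case: ifP => // _; rewrite measure0.
  rewrite -lee_fin -sumEFin; under eq_bigr do rewrite fineK//.
  rewrite -(measure_bigsetU nu mA tA).
  have ti : tau <= ball_radius (p_ i) by apply: Ctau; exact: p_C.
  apply: (@carleson_box _ (Defs.ball_center (p_ i)) (9 / 10 * ball_radius (p_ i))).
  + exact: bigsetU_measurable.
  + by rewrite mulr_gt0// ?divr_gt0// ball_radius_gt0.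
  move=> q; rewrite -bigcup_mkord => -[k _]; rewrite /A; case: ifP => // /andP[ik Nik].
  move=> /QF[_ [_ [/= Nkq [_ /= rq]]]].
  have := body_norm_tri Kbody (Defs.ball_center (p_ i)) (Defs.ball_center (p_ k))
    (Defs.ball_center q).
  by rewrite /d in Nkq rq; split; lra.
have L0 : 0 <= L.
  have [z [_ Dz]] := dD (ex_intro _ (0 : 'rV[R]_n) I) openT.
  by rewrite mulr_ge0// -lee_fin (le_trans _ (nuM Dz)).
apply: le_trans Sle _; apply: ler_wpM2l => //.
by rewrite -lee_fin (le_trans _ fs)//; exact: S1_norm_ge_family.
Qed.

Lemma carleson_embedding :
  (\int[nu]_p (`|f p|)%:E <= ((cone_cover_card n)%:R * M * s)%:E)%E.
Proof.
have [oV Vmono Vcov VC] := @half_exhaustionP R n.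
have cnf := continuous_fct_norm cf.
have mnf : measurable_fun setT ((fun q => (`|f q|)%:E) : B -> \bar R).
  by apply/measurable_EFinP; exact: continuous_measurable_borel.
have VT : \bigcup_j half_exhaustion j = [set: B].
  by apply/seteqP; split => // p _; have [j Vj] := Vcov p; exists j.
have := @ge0_nondecreasing_set_cvg_integral _ B R half_exhaustion
  (fun q => (`|f q|)%:E) nu.
rewrite VT => cvgV.
have {}cvgV : (\int[nu]_(q in half_exhaustion j) (`|f q|)%:E @[j --> \oo] -->
    \int[nu]_q (`|f q|)%:E)%E.
  apply: cvgV => //.
  - by move=> i j ij; apply/subsetPset; exact: Vmono.
  - by move=> j; apply: open_measurable_borel.
  - by move=> j; exact: measurable_funTS.
rewrite -(cvg_lim _ cvgV)//; apply: lime_le; first by apply/cvg_ex; eexists; exact: cvgV.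
by apply: nearW => j; have [C cC VjC] := VC j; exact: carleson_compact VjC.
Qed.

End carleson_embedding.

(** * The measure of a bounded functional *)

Section compactly_supported_S1.
Context {R : realType} {n : nat} (K : set 'rV[R]_n).
Hypothesis Kbody : symmetric_convex_body K.
Local Notation N := (body_norm K).
Local Notation H := (upper_half R n).
Implicit Types (p q : H) (f g : H -> R).

Lemma half_hausdorff : hausdorff_space H.
Proof.
rewrite ball_hausdorff => a b ab.
have ab0 : 0 < `|(set_val a : 'rV[R]_n * R) - set_val b| / 2.
  rewrite divr_gt0// normr_gt0 subr_eq0.
  by apply: contra_neq ab => /val_inj.
exists (PosNum ab0, PosNum ab0) => /=; apply/eqP/seteqP; split => // q.
move=> [/half_ballE aq /half_ballE bq].
have := ler_distD (set_val q : 'rV[R]_n * R) (set_val a) (set_val b).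
by rewrite [X in _ <= _ + X]distrC => abq; lra.
Qed.

Lemma cc_compact_closure f : cc f <->
  continuous f /\ compact (closure [set p | f p != 0]).
Proof.
split=> -[cf]; last first.
  by move=> cC; split => //; exists (closure [set p | f p != 0]) => //;
    exact: subset_closure.
move=> [C cC fC]; split => //; apply: (subclosed_compact _ cC).
  exact: closed_closure.
rewrite [X in _ `<=` X](closure_id C).1; last first.
  exact: compact_closed half_hausdorff cC.
exact: closure_subset.
Qed.

Local Open Scope ereal_scope.

(** Two disjoint balls do not both contain z. *)
Lemma S1_norm_bump_le1 z g : (forall p, `|g p| <= 1)%R ->
  (forall p, g p != 0%R -> open_cone K z p) -> S1_norm K g <= 1.
Proof.
move=> g1 gz; apply: ge_ereal_sup => _ [C [finC tC] <-].
have [[p Cp gp]|g0] := pselect (exists2 p, C p & g p != 0%R); last first.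
  rewrite fsbig1// => p Cp; congr EFin; apply/eqP; rewrite normr_eq0.
  by apply: contrapT => /negP gp; apply: g0; exists p.
rewrite (fsbigD1 p)//= fsbig1 ?adde0 ?lee_fin// => q [Cq qp].
congr EFin; apply/eqP; rewrite normr_eq0; apply/negPn/negP => gq.
apply: qp; apply: tC => //; exists z.
by split; rewrite /ball_of /body_ball /=; exact/ltW/gz.
Qed.

Lemma le_S1_norm f g : (forall p, `|f p| <= `|g p|)%R ->
  S1_norm K f <= S1_norm K g.
Proof.
move=> fg; apply: ge_ereal_sup => _ [C [finC tC] <-].
apply: (@le_trans _ _ (\sum_(p \in C) `|g p|%:E)).
  by apply: lee_fsum => // p _; rewrite lee_fin.
by apply: ereal_sup_ubound; exists C.
Qed.

(** A compact set is covered by finitely many open cones, and the S1 norm of the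
    indicator of each of them is at most 1. *)
Lemma S1_norm_compact (C : set H) : compact C ->
  exists m : nat, forall f, (forall p, f p != 0%R -> C p) ->
    (forall p, `|f p| <= 1)%R -> S1_norm K f <= m%:R%:E.
Proof.
rewrite compact_cover => /(_ _ setT (fun p => open_cone K (Defs.ball_center p))).
case=> [p _|p _|D _ CD]; first exact: open_open_cone.
  by exists p => //; rewrite /open_cone /= subrr body_norm0// ball_radius_gt0.
exists (size (enum_fset D)) => f fC f1.
pose h p : H -> R := \1_(open_cone K (Defs.ball_center p)).
have h01 p q : (`|h p q| <= 1)%R by rewrite /h indicE; case: (_ \in _); rewrite ?normr1 ?normr0.
apply: (@le_trans _ _ (S1_norm K (\sum_(p <- enum_fset D) h p)%R)).
  apply: le_S1_norm => q; rewrite fct_sumE.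
  have h0 p : (0 <= h p q)%R by rewrite /h indicE ler0n.
  rewrite [leRHS]ger0_norm ?sumr_ge0//.
  have [->|/fC/CD[p pD qp]] := eqVneq (f q) 0%R; first by rewrite normr0 sumr_ge0.
  rewrite (le_trans (f1 q))// (big_rem p)//= {1}/h indicE mem_set//.
  by rewrite lerDl sumr_ge0.
elim: (enum_fset D) => [|p s IH] /=.
  by rewrite big_nil -(scale0r (0 : H -> R)%R) S1_normZ normr0 mul0e.
rewrite big_cons -natr1 addrC EFinD; apply: le_trans (S1_normD _ _ _) _.
apply: leeD => //; apply: (@S1_norm_bump_le1 (Defs.ball_center p)) => // q.
rewrite /h indicE; have [/set_mem//|] := boolP (q \in _).
by rewrite eqxx.
Qed.

Lemma cc_in_S1 f : cc f -> f \in in_S1 K.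
Proof.
move=> cf; have [cf' [C cC fC]] := cf; have [M M0 fM] := cc_bounded cf.
apply/asboolP; split => //; have [m mP] := S1_norm_compact cC.
have -> : f = (M *: (M^-1 *: f))%R by rewrite scalerA divff ?scale1r// gt_eqF.
rewrite S1_normZ lte_mul_pinfty//.
apply: le_lt_trans (ltry m%:R); apply: mP => p.
  by rewrite /GRing.scale/= mulf_eq0 negb_or => /andP[_ /fC].
rewrite /GRing.scale/= normrM gtr0_norm ?invr_gt0//.
by rewrite ler_pdivrMl// mulr1.
Qed.

Lemma S1_fun_insubd f : cc f -> S1_fun (insubd 0%R f : S1 K) = f.
Proof. by move=> cf; rewrite -[S1_fun _]/(\val _) insubdK// cc_in_S1. Qed.

Lemma cc_S1_0 f : cc f -> S1_0 K (insubd 0%R f).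
Proof.
move=> cf; apply: subset_closure; rewrite /= S1_fun_insubd//.
by case/cc_compact_closure : cf.
Qed.

End compactly_supported_S1.

Section functional_measure.
Context {R : realType} {n : nat} (K : set 'rV[R]_n).
Hypothesis Kbody : symmetric_convex_body K.
Local Notation N := (body_norm K).
Local Notation H := (upper_half R n).
Local Notation B := (borel_half R n).

(** The default value 0 is never used on functions with compact support, all of
    which belong to S1. *)
Definition cc_functional (l : S1 K -> R) (f : H -> R) : R := l (insubd 0 f).

Section fixed_functional.
Variables (l : S1 K -> R) (Lam : R).
Hypotheses (l_lin : linear_on (S1_0 K) l).
Hypothesis l_bnd : forall f, S1_0 K f -> `|l f| <= Lam * `|f|.

Lemma cc_functional_linear : linear_cc (cc_functional l).
Proof.
move=> a f g cf cg; rewrite /cc_functional.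
rewrite -l_lin; [|exact: cc_S1_0|exact: cc_S1_0]; congr l.
apply: val_inj; rewrite /= S1_fun_insubd//; last by apply: ccD => //; exact: ccZ.
transitivity (fun p => a * (insubd 0 f : S1 K) p + (insubd 0 g : S1 K) p) => //.
by apply/funext => p; rewrite !S1_fun_insubd.
Qed.

Lemma cc_functional_le f (s : R) : 0 <= Lam -> cc f ->
  (S1_norm K f <= s%:E)%E -> `|cc_functional l f| <= Lam * s.
Proof.
move=> Lam0 cf fs; rewrite (le_trans (l_bnd _))//; first exact: cc_S1_0.
by rewrite ler_wpM2l// -lee_fin S1_normE S1_fun_insubd.
Qed.

End fixed_functional.

Section S1_bounded.
Variables (lc : (H -> R) -> R) (Lam : R).
Hypotheses (lc_lin : linear_cc lc) (Lam0 : 0 <= Lam).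
Hypothesis lc_le : forall f s, cc f -> (S1_norm K f <= s%:E)%E ->
  `|lc f| <= Lam * s.

Lemma S1_locally_bounded : locally_bounded_cc lc.
Proof.
move=> C cC; have [m mP] := S1_norm_compact Kbody cC.
exists (Lam * m%:R) => f cf fC f1; apply: le_trans (ler_norm _) _.
by apply: lc_le => //; exact: mP.
Qed.

Local Notation P := (riesz_measure upper_half_bumps lc_lin S1_locally_bounded).
Local Open Scope ereal_scope.

(** The mass of an open cone is the supremum of lc over functions with values in
    the unit interval that vanish outside of the cone; their S1 norm is at most 1. *)
Lemma riesz_open_cone z : P (open_cone K z) <= Lam%:E.
Proof.
rewrite riesz_measure_open; last exact: open_open_cone.
apply: ge_ereal_sup => _ [g [cg g01 gz] <-].
rewrite lee_fin (le_trans (ler_norm _))// -[leRHS]mulr1; apply: lc_le => //.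
by apply: (S1_norm_bump_le1 (z := z)) => // p; rewrite ger0_norm; case/andP: (g01 p).
Qed.

(** On a relatively compact set the radii are bounded below by some t > 0. The
    part of the cone with radii at least t is covered by finitely many open cones. *)
Lemma riesz_cone (A : set B) x : relcompact_borel A -> A `<=` cone K x ->
  P A <= ((cone_cover_card n)%:R * Lam)%:E.
Proof.
move=> [mA [C cC AsC]] Ax.
have [t t0 Ct] := compact_pos_lb (@continuous_ball_radius R n) cC
  (fun p _ => ball_radius_gt0 p).
have dT : dense [set: 'rV[R]_n] by move=> O [y Oy] _; exists y.
have [z [_ zP]] := cone_cover Kbody x dT t0.
apply: (@le_trans _ _ (\sum_k P (open_cone K (z k)))).
  apply: measure_finite_cover => // [k|q Aq].
    by apply: open_measurable_borel; exact: open_open_cone.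
  have [||k kq] := zP (Defs.ball_center q) (ball_radius q).
  - exact/Ct/AsC.
  - by rewrite (le_trans (Ax _ Aq))// lerDl mulr_ge0// ltW.
  by exists k.
apply: (@le_trans _ _ (\sum_(k : {ffun 'I_n -> 'I_(24 * n).+1}) Lam%:E)).
  by apply: lee_sum => k _; exact: riesz_open_cone.
by rewrite sumEFin lee_fin sumr_const -[leLHS]mulr_natl.
Qed.

End S1_bounded.

Local Open Scope ereal_scope.

(** The measure is the difference of the Riesz measures of lc and of - lc. Both
    are bounded on the relatively compact subsets of a cone, and they dominate the
    two variations of the difference. *)
Lemma functional_measure (lc : (H -> R) -> R) (Lam : R) :
  linear_cc lc -> (0 <= Lam)%R ->
  (forall f s, cc f -> S1_norm K f <= s%:E -> (`|lc f| <= Lam * s)%R) ->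
  exists mu : set H -> R, [/\ signed_radon mu,
    forall f, cc f -> lc f = signed_integral mu f &
    forall x, A1 K mu x <= (2 * (cone_cover_card n)%:R * Lam)%:E].
Proof.
move=> lc_lin Lam0 lc_le; pose lc' f := (- lc f)%R.
have lc'_lin : linear_cc lc'.
  by move=> a f g cf cg; rewrite /lc' lc_lin// opprD mulrN.
have lc'_le f s : cc f -> S1_norm K f <= s%:E -> (`|lc' f| <= Lam * s)%R.
  by move=> cf fs; rewrite normrN; exact: lc_le.
pose P := riesz_measure upper_half_bumps lc_lin (S1_locally_bounded lc_le).
pose Q := riesz_measure upper_half_bumps lc'_lin (S1_locally_bounded lc'_le).
have Pfin : locally_finite P by exact: riesz_locally_finite.
have Qfin : locally_finite Q by exact: riesz_locally_finite.
have mu_radon := measure_diff_signed_radon Pfin Qfin.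
exists (measure_diff P Q); split => // [f cf|x].
  rewrite (signed_integral_cc mu_radon Pfin Qfin _ cf); last first.
    by move=> A; exact: measure_diffE.
  exact: riesz_representation.
have -> : (2 * (cone_cover_card n)%:R * Lam)%:E =
    ((cone_cover_card n)%:R * Lam)%:E + ((cone_cover_card n)%:R * Lam)%:E.
  by rewrite -EFinD; congr EFin; lra.
apply: leeD; apply: ge_ereal_sup => _ [A [rA Ax] <-].
  by apply: le_trans (measure_diff_le Pfin Qfin rA) _; exact: riesz_cone Ax.
rewrite /measure_diff opprB.
by apply: le_trans (measure_diff_le Qfin Pfin rA) _; exact: riesz_cone Ax.
Qed.

End functional_measure.

(** * Linear functionals on a subspace *)

Section functionals_on_subspaces.
Context {R : realType} {V : normedModType R}.
Variables (A : set V) (l : V -> R).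
Hypotheses (A0 : A 0) (AD : forall a f g, A f -> A g -> A (a *: f + g)).
Hypothesis l_lin : linear_on A l.

Lemma linear_on0 : l 0 = 0.
Proof.
have := l_lin (-1) A0 A0; rewrite scaler0 addr0 mulN1r => h; lra.
Qed.

Lemma linear_onZ a f : A f -> l (a *: f) = a * l f.
Proof. by move=> Af; have := l_lin a Af A0; rewrite !addr0 linear_on0 addr0. Qed.

Lemma linear_onB f g : A f -> A g -> l (f - g) = l f - l g.
Proof.
move=> Af Ag; rewrite addrC -scaleN1r (l_lin _ Ag Af) mulN1r.
by rewrite addrC.
Qed.

Lemma subspaceZ a f : A f -> A (a *: f).
Proof. by move=> Af; rewrite -[_ *: _]addr0; exact: AD. Qed.

Lemma dual_norm_ge0 : (0 <= dual_norm A l)%E.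
Proof.
apply: (@le_trans _ _ (`|l 0|)%:E); first by rewrite lee_fin.
by apply: ereal_sup_ubound; exists 0 => //; split => //; rewrite normr0.
Qed.

Lemma dual_norm_le (C : R) : 0 <= C ->
  (forall f, A f -> `|l f| <= C * `|f|) -> (dual_norm A l <= C%:E)%E.
Proof.
move=> C0 lC; apply: ge_ereal_sup => _ [f [Af f1] <-]; rewrite lee_fin.
by rewrite (le_trans (lC _ Af))// -[leRHS]mulr1 ler_wpM2l.
Qed.

Lemma le_dual_norm (C : R) : (dual_norm A l <= C%:E)%E ->
  forall f, A f -> `|l f| <= C * `|f|.
Proof.
move=> lC f Af; have [->|f0] := eqVneq f 0.
  by rewrite linear_on0 !normr0 mulr0.
have nf : 0 < `|f| by rewrite normr_gt0.
rewrite -ler_pdivrMr// mulrC.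
have : (`|l (`|f|^-1 *: f)|%:E <= C%:E)%E.
  apply: le_trans lC; apply: ereal_sup_ubound; exists (`|f|^-1 *: f) => //.
  split; first exact: subspaceZ.
  by rewrite normrZ normfV normr_id mulVf ?gt_eqF.
by rewrite lee_fin linear_onZ// normrM normfV normr_id.
Qed.

Lemma continuous_linear_on_bounded : {within A, continuous l} ->
  exists2 C, 0 <= C & forall f, A f -> `|l f| <= C * `|f|.
Proof.
move=> lcont.
have : within A (nbhs 0) [set f | ball (l 0) 1 (l f)].
  rewrite (nbhs_subspace_in A0).
  exact: (lcont 0 _ (nbhsx_ballx (l 0) 1 ltr01)).
move=> /nbhs_ballP[d /= d0 dP].
have lt1 f : A f -> `|f| < d -> `|l f| < 1.
  move=> Af fd; have := dP f; rewrite -!ball_normE /= linear_on0 !sub0r !normrN.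
  exact.
exists (2 / d); first by rewrite divr_ge0// ltW.
move=> f Af; have [->|f0] := eqVneq f 0; first by rewrite linear_on0 !normr0 mulr0.
have nf : 0 < `|f| by rewrite normr_gt0.
pose a := d / 2 / `|f|; have a0 : 0 < a by rewrite !divr_gt0.
have := lt1 (a *: f) (subspaceZ _ Af).
rewrite normrZ linear_onZ// [ `|a * _|]normrM (gtr0_norm a0) => h.
have {}h : a * `|l f| < 1 by apply: h; rewrite /a divfK ?gt_eqF//; lra.
have -> : 2 / d * `|f| = a^-1 by rewrite /a; field; rewrite !gt_eqF.
by rewrite -[leRHS]mulr1 ler_pdivlMl// ltW.
Qed.

End functionals_on_subspaces.

(** * The closure of the compactly supported functions *)

Section S1_0_theory.
Context {R : realType} {n : nat} (K : set 'rV[R]_n).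
Local Notation H := (upper_half R n).
Implicit Types (f g : S1 K).

Lemma S1_0P f : S1_0 K f <-> forall e : R, 0 < e ->
  exists2 g : S1 K, cc (g : H -> R) & `|f - g| < e.
Proof.
split=> [fcl e e0|fP].
  have [g [gcc]] := fcl _ (nbhsx_ballx f e e0).
  rewrite -ball_normE => fg; exists g => //; apply/cc_compact_closure; split => //.
  by have /asboolP[] := S1_funP g.
move=> B /nbhs_ballP[e /= e0 eB]; have [g gcc fg] := fP e e0.
exists g; split; last by apply: eB; rewrite -ball_normE.
by case/cc_compact_closure : gcc.
Qed.

Lemma cc_sub_S1_0 f : cc (f : H -> R) -> S1_0 K f.
Proof. by move=> cf; apply/S1_0P => e e0; exists f => //; rewrite subrr normr0. Qed.

Lemma S1_00 : S1_0 K 0.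
Proof. by apply: cc_sub_S1_0; exact: cc0. Qed.

Lemma S1_0D a f g : S1_0 K f -> S1_0 K g -> S1_0 K (a *: f + g).
Proof.
move=> /S1_0P fP /S1_0P gP; apply/S1_0P => e e0.
have a1 : 0 < `|a| + 1 by rewrite ltr_wpDl.
have [|f' cf' ff'] := fP (e / 2 / (`|a| + 1)); first by rewrite !divr_gt0.
have [|g' cg' gg'] := gP (e / 2); first by rewrite divr_gt0.
exists (a *: f' + g'); first by apply: ccD => //; exact: ccZ.
rewrite opprD addrACA -scalerBr (le_lt_trans (ler_normD _ _))//.
rewrite (splitr e) ler_ltD// normrZ.
move: ff'; rewrite ltr_pdivlMr// => /ltW; apply: le_trans.
by rewrite mulrC ler_wpM2l// lerDl.
Qed.

End S1_0_theory.

(** * The pairing of T1 with S1 *)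

Section T1_pairing.
Context {R : realType} {n : nat} (K : set 'rV[R]_n).
Hypothesis Kbody : symmetric_convex_body K.
Local Notation H := (upper_half R n).
Local Notation B := (borel_half R n).
Local Open Scope ereal_scope.

(** For v < 0 the set would be the whole space, which is not a null set. *)
Lemma Linfty_norm_member (g : 'rV[R]_n -> \bar R) v :
  lebesgue_outer [set x | v < `|g x|] = 0 -> 0 <= v.
Proof.
move=> /lebesgue_null_dense gv; rewrite leNgt; apply/negP => v0.
have [x [_]] := gv setT (ex_intro _ 0%R I) openT; apply => /=.
exact: lt_le_trans v0 (abse_ge0 _).
Qed.

Lemma Linfty_norm_le (n_gt0 : (0 < n)%N) (g : 'rV[R]_n -> \bar R) v :
  (forall x, `|g x| <= v) -> Linfty_norm g <= v.
Proof.
move=> gv; apply: ereal_inf_lbound => /=.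
rewrite (_ : [set x | _] = set0) ?lebesgue_outer0//.
by apply/seteqP; split => // x /=; rewrite ltNge gv.
Qed.

Variables (mu : set H -> R) (M : R).
Hypotheses (mu_radon : signed_radon mu)
  (muM : lebesgue_outer [set x | M%:E < `|A1 K mu x|] = 0).
Let muN_radon := signed_radonN mu_radon.
Local Notation P := (positive_variation mu_radon).
Local Notation Q := (positive_variation muN_radon).
Implicit Types f g : S1 K.

Lemma variation_measureE :
  variation_measure mu = measure_add P Q :> (set B -> \bar R).
Proof. by apply/funext => A; apply/esym/measure_addE. Qed.

Lemma S1_measurable f : measurable_fun [set: B] (EFin \o (f : H -> R)).
Proof.
apply/measurable_EFinP; apply: continuous_measurable_borel.
by have /asboolP[] := S1_funP f.
Qed.

(** The bound on the cones holds for the vertices outside of a null set, and these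
    vertices are dense. *)
Lemma integral_variation_le f : \int[variation_measure mu]_p `|(f p)%:E| <=
  ((cone_cover_card n)%:R * M * `|f|)%:E.
Proof.
rewrite variation_measureE.
apply: (carleson_embedding Kbody _ (lebesgue_null_dense muM)).
- by apply: locally_finiteD; exact: variation_locally_finite.
- move=> z /= /negP; rewrite -leNgt /A1 => zM.
  have {}zM : variation_measure mu (cone K z) <= M%:E by exact: le_trans (lee_abs _) zM.
  by move: zM; rewrite variation_measureE.
- by have /asboolP[] := S1_funP f.
- by rewrite S1_normE.
Qed.

Lemma S1_integrable_variation f :
  (variation_measure mu).-integrable [set: B] (EFin \o (f : H -> R)).
Proof.
apply/integrableP; split; first exact: S1_measurable.
by apply: le_lt_trans (integral_variation_le f) _; exact: ltry.
Qed.

Lemma integral_parts_le f : \int[P]_p `|(f p)%:E| + \int[Q]_p `|(f p)%:E| <=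
  ((cone_cover_card n)%:R * M * `|f|)%:E.
Proof.
rewrite -ge0_integral_measure_add//.
  by apply: le_trans (integral_variation_le f); rewrite variation_measureE.
by apply: measurableT_comp => //; exact: S1_measurable.
Qed.

Lemma S1_integrable_parts f :
  P.-integrable [set: B] (EFin \o (f : H -> R)) /\
  Q.-integrable [set: B] (EFin \o (f : H -> R)).
Proof.
have := le_lt_trans (integral_parts_le f) (ltry _) => fPQ.
by split; apply/integrableP; split; [exact: S1_measurable| |exact: S1_measurable|];
  apply: le_lt_trans fPQ; rewrite ?leeDl ?leeDr// integral_ge0.
Qed.

Lemma signed_integralE f : signed_integral mu f =
  (fine (\int[P]_p (f p)%:E) - fine (\int[Q]_p (f p)%:E))%R.
Proof. by []. Qed.

Lemma signed_integral_S1_le f :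
  (`|signed_integral mu f| <= (cone_cover_card n)%:R * M * `|f|)%R.
Proof.
rewrite signed_integralE; have [iP iQ] := S1_integrable_parts f.
apply: le_trans (ler_normB _ _) _; rewrite -lee_fin EFinD.
apply: le_trans (integral_parts_le f).
have fin (m : {measure set B -> \bar R}) : m.-integrable setT (EFin \o (f : H -> R)) ->
    `|fine (\int[m]_p (f p)%:E)|%:E <= \int[m]_p `|(f p)%:E|.
  move=> im; rewrite -[_%:E]/(`|(fine (\int[m]_p (f p)%:E))%:E|).
  rewrite fineK; last exact: integrable_fin_num im.
  by apply: le_abse_integral => //; exact: S1_measurable.
by apply: leeD; exact: fin.
Qed.

Lemma signed_integral_S1_linear (a : R) f g : signed_integral mu (a *: f + g)%R =
  (a * signed_integral mu f + signed_integral mu g)%R.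
Proof.
rewrite !signed_integralE.
have [fP fQ] := S1_integrable_parts f; have [gP gQ] := S1_integrable_parts g.
have lin (m : {measure set B -> \bar R}) :
    m.-integrable setT (EFin \o (f : H -> R)) -> m.-integrable setT (EFin \o (g : H -> R)) ->
    fine (\int[m]_p ((a *: f + g)%R p)%:E) =
    (a * fine (\int[m]_p (f p)%:E) + fine (\int[m]_p (g p)%:E))%R.
  move=> fm gm; have ffin := integrable_fin_num measurableT fm.
  have gfin := integrable_fin_num measurableT gm.
  rewrite (_ : \int[m]_p _ = \int[m]_p (a%:E * (f p)%:E + (g p)%:E)); last by [].
  rewrite integralD//; last exact: integrableZl.
  rewrite integralZl// fineD ?fin_numM// fineM//.
rewrite !lin//; lra.
Qed.

End T1_pairing.

(** * Duality *)

Section duality.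
Context {R : realType} {n : nat} (K : set 'rV[R]_n).
Hypothesis Kbody : symmetric_convex_body K.
Local Notation H := (upper_half R n).
Local Notation c := (2 * (cone_cover_card n)%:R : R)%R.
Implicit Types (mu : set H -> R) (f g : S1 K).
Local Open Scope ereal_scope.

Lemma cone_cover_card_ge1 : (1 <= (cone_cover_card n)%:R :> R)%R.
Proof.
rewrite ler1n; apply/card_gt0P; exists [ffun=> ord0].
by [].
Qed.

Lemma variation_measure_eq mu mu' :
  (forall A, relcompact_borel A -> mu A = mu' A) ->
  variation_measure mu = variation_measure mu'.
Proof.
move=> mumu'; apply/funext => E; rewrite /variation_measure /lower_variation.
by congr (_ + _); congr ereal_sup; apply/seteqP; split => _ [A [rA AE] <-];
  exists A => //; rewrite mumu'.
Qed.

Lemma T1_norm_member mu : T1_norm K mu < +oo ->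
  exists M : R, lebesgue_outer [set x | M%:E < `|A1 K mu x|] = 0.
Proof.
move=> /ereal_inf_lt[v /= vmu]; have := Linfty_norm_member vmu.
by case: v vmu => // M; exists M.
Qed.

Lemma T1_norm_le (n_gt0 : (0 < n)%N) mu (M : R) : signed_radon mu ->
  (forall x, A1 K mu x <= M%:E) -> T1_norm K mu <= M%:E.
Proof.
move=> h muM; apply: Linfty_norm_le => // x.
rewrite gee0_abs// adde_ge0// upper_variation_ge0//.
exact: signed_radonN.
Qed.

Lemma signed_integral_linear_on mu : T1 K mu ->
  linear_on (S1_0 K) (fun f => signed_integral mu f).
Proof.
move=> [h /T1_norm_member[M muM]] a f g _ _.
exact: (signed_integral_S1_linear Kbody h muM).
Qed.

Lemma dual_norm_signed_integral_le mu (M : R) : signed_radon mu ->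
  lebesgue_outer [set x | M%:E < `|A1 K mu x|] = 0 ->
  dual_norm (S1_0 K) (fun f => signed_integral mu f) <=
    ((cone_cover_card n)%:R * M)%:E.
Proof.
move=> h muM; have M0 : (0 <= M)%R by rewrite -lee_fin (Linfty_norm_member muM).
apply: dual_norm_le; first by rewrite mulr_ge0.
by move=> f _; exact: (signed_integral_S1_le Kbody h muM).
Qed.

(** Representing the functional of mu yields a measure that is bounded on the
    cones by a multiple of the dual norm; it coincides with mu by uniqueness. *)
Lemma T1_norm_le_dual_norm (n_gt0 : (0 < n)%N) mu (Lam : R) : T1 K mu ->
  dual_norm (S1_0 K) (fun f => signed_integral mu f) <= Lam%:E ->
  T1_norm K mu <= (c * Lam)%:E.
Proof.
move=> T1mu; set l := fun f : S1 K => _ => lLam.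
have l_lin : linear_on (S1_0 K) l by exact: signed_integral_linear_on.
have Lam0 : (0 <= Lam)%R.
  by rewrite -lee_fin (le_trans _ lLam)//; apply: dual_norm_ge0; exact: S1_00.
have l_le := le_dual_norm (@S1_00 _ _ K) (@S1_0D _ _ K) l_lin lLam.
have [mu' [h' lmu' mu'_le]] := functional_measure Kbody
  (cc_functional_linear Kbody l_lin) Lam0
  (fun u s => cc_functional_le Kbody l_le Lam0).
have [h _] := T1mu.
have mumu' := signed_radon_unique h h'.
apply: T1_norm_le => // x; rewrite /A1 (@variation_measure_eq mu mu'); first exact: mu'_le.
apply: signed_radon_unique => // f cf.
by rewrite -lmu'// /cc_functional /l S1_fun_insubd.
Qed.

Lemma dual_norm_comparable (n_gt0 : (0 < n)%N) mu : T1 K mu ->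
  dual_norm (S1_0 K) (fun f => signed_integral mu f) < +oo /\
  comparable_by c (dual_norm (S1_0 K) (fun f => signed_integral mu f))
    (T1_norm K mu).
Proof.
move=> T1mu; have [h /T1_norm_member[M muM]] := T1mu.
have fin := le_lt_trans (dual_norm_signed_integral_le h muM) (ltry _).
split => //; set D := dual_norm _ _ in fin *.
have D0 : 0 <= D by apply: dual_norm_ge0; exact: S1_00.
have Dfin : D \is a fin_num by rewrite ge0_fin_numE.
have c0 : (0 < c)%R.
  by rewrite mulr_gt0// (lt_le_trans ltr01)// cone_cover_card_ge1.
split; last first.
  rewrite -(fineK Dfin) -EFinM; apply: T1_norm_le_dual_norm => //.
  by rewrite fineK.
apply: le_ereal_inf_tmp => v /= vmu; have := Linfty_norm_member vmu.
case: v vmu => [M' muM'|_ _|//]; last exact: leey.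
rewrite lee_fin => M'0.
rewrite -(fineK Dfin) -EFinM lee_fin ler_pdivrMl//.
rewrite -lee_fin fineK//; apply: le_trans (dual_norm_signed_integral_le h muM') _.
by rewrite lee_fin -mulrA ler_peMl ?mulr_ge0// ler1n.
Qed.

(** S1_0 is the closure of the functions with compact support. *)
Lemma bounded_functional_eq (l l' : S1 K -> R) (C C' : R) :
  linear_on (S1_0 K) l -> linear_on (S1_0 K) l' ->
  (forall f, S1_0 K f -> `|l f| <= C * `|f|)%R ->
  (forall f, S1_0 K f -> `|l' f| <= C' * `|f|)%R ->
  (forall f, cc (f : H -> R) -> l f = l' f) ->
  forall f, S1_0 K f -> l f = l' f.
Proof.
move=> l_lin l'_lin lC l'C ll' f Sf; apply/eqP; rewrite -subr_eq0 -normr_le0.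
apply/ler_addgt0Pr => e e0; rewrite add0r.
have E0 : (0 < `|C| + `|C'| + 1)%R by rewrite ltr_wpDl ?addr_ge0.
have [|g cg fg] := (S1_0P f).1 Sf (e / (`|C| + `|C'| + 1))%R.
  by rewrite divr_gt0.
have Sg := cc_sub_S1_0 cg.
have Sfg : S1_0 K (f - g)%R.
  by rewrite addrC -scaleN1r; exact: S1_0D.
have -> : (l f - l' f = l (f - g) - l' (f - g))%R.
  rewrite (linear_onB l_lin)// (linear_onB l'_lin)//.
  by rewrite (ll' _ cg); lra.
apply: le_trans (ler_normB _ _) _.
apply: le_trans (lerD (lC _ Sfg) (l'C _ Sfg)) _; rewrite -mulrDl.
move: fg; rewrite ltr_pdivlMr// => /ltW; apply: le_trans.
rewrite mulrC ler_wpM2l//.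
have := ler_norm C; have := ler_norm C'; lra.
Qed.

(** The functional is bounded on functions with compact support, hence represented
    there by a measure. The integral against this measure is bounded on S1 as well,
    by the Carleson embedding, and both sides agree by density. *)
Lemma functional_representation (n_gt0 : (0 < n)%N) (l : S1 K -> R) :
  linear_on (S1_0 K) l -> {within S1_0 K, continuous l} ->
  exists2 mu, T1 K mu & forall f, S1_0 K f -> l f = signed_integral mu f.
Proof.
move=> l_lin l_cont.
have [Lam Lam0 l_le] :=
  continuous_linear_on_bounded (@S1_00 _ _ K) (@S1_0D _ _ K) l_lin l_cont.
have [mu [h lmu mu_le]] := functional_measure Kbody
  (cc_functional_linear Kbody l_lin) Lam0
  (fun u s => cc_functional_le Kbody l_le Lam0).
have T1mu : T1 K mu.
  by split => //; apply: le_lt_trans (T1_norm_le n_gt0 h mu_le) _; exact: ltry.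
exists mu => //; have [_ /T1_norm_member[M muM]] := T1mu.
apply: (bounded_functional_eq l_lin _ l_le).
- exact: signed_integral_linear_on.
- by move=> f _; exact: (signed_integral_S1_le Kbody h muM).
move=> f cf; rewrite -lmu// /cc_functional; congr l.
by apply: val_inj; rewrite /= S1_fun_insubd.
Qed.

End duality.

Theorem theorem2p4 (R : realType) (n : nat) (n_gt0 : (0 < n)%N) :
  exists2 c : R, 1 <= c &
  forall K : set 'rV[R]_n, symmetric_convex_body K ->
  (forall mu : set (upper_half R n) -> R, T1 K mu ->
     [/\ forall f : S1 K, S1_0 K f ->
           (variation_measure mu).-integrable [set: borel_half R n] (EFin \o f),
         linear_on (S1_0 K) (fun f : S1 K => signed_integral mu f),
         (dual_norm (S1_0 K) (fun f : S1 K => signed_integral mu f) < +oo)%E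
       & comparable_by c
           (dual_norm (S1_0 K) (fun f : S1 K => signed_integral mu f))
           (T1_norm K mu)])
  /\
  (forall l : S1 K -> R,
     linear_on (S1_0 K) l -> {within S1_0 K, continuous l} ->
     exists mu : set (upper_half R n) -> R,
       [/\ T1 K mu,
           forall f : S1 K, S1_0 K f -> l f = signed_integral mu f,
           comparable_by c (dual_norm (S1_0 K) l) (T1_norm K mu)
         & forall mu' : set (upper_half R n) -> R, T1 K mu' ->
             (forall f : S1 K, S1_0 K f -> l f = signed_integral mu' f) ->
             forall A, relcompact_borel A -> mu' A = mu A]).
Proof.
exists (2 * (cone_cover_card n)%:R).
  by rewrite mulr_ege1// ?cone_cover_card_ge1// ler1n.
move=> K Kbody; split=> [mu T1mu|l l_lin l_cont].
  have [dual_fin dual_comp] := dual_norm_comparable Kbody n_gt0 T1mu.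
  split => //; last exact: signed_integral_linear_on.
  move=> f _; have [h /T1_norm_member[M muM]] := T1mu.
  exact: (S1_integrable_variation Kbody h muM).
have [mu T1mu lmu] := functional_representation Kbody n_gt0 l_lin l_cont.
exists mu; split => // [|mu' T1mu' lmu' A rA].
  rewrite (_ : dual_norm _ l = dual_norm (S1_0 K) (fun f => signed_integral mu f)).
    by have [] := dual_norm_comparable Kbody n_gt0 T1mu.
  by congr ereal_sup; apply/seteqP; split => _ [f [Sf f1] <-]; exists f => //;
    rewrite lmu.
apply: signed_radon_unique rA => [||f cf]; [by case: T1mu'|by case: T1mu|].
by rewrite -(S1_fun_insubd Kbody cf) -lmu' ?lmu//; exact: cc_S1_0.
Qed.
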